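(* Let $k$ be an algebraically closed field, let $g_1,\ldots,g_n\in k[x_1,\ldots,x_n]$ be nonzero polynomials in $n$ variables, and put $\mathcal G=\{g_1,\ldots,g_n\}$. Suppose that $g_1,\ldots,g_n$ have no intersection at infinity. Then the sum of intersection multiplicities $$\sum_{x\in k^n} I_x(\mathcal G)$$ is equal either to $\deg(g_1)\cdots\deg(g_n)$ or to $\infty$.
   Context: $\mathbb Z_+$ denotes the set of nonnegative integers. For $\alpha=(\alpha_1,\ldots,\alpha_n)\in\mathbb Z_+^n$, $D^\alpha=\left(\frac{\partial}{\partial x_1}\right)^{\alpha_1}\cdots\left(\frac{\partial}{\partial x_n}\right)^{\alpha_n}$ is the (formal) partial derivative acting on $k[x_1,\ldots,x_n]$. For a polynomial $q=\sum_\alpha q_\alpha x^\alpha\in k[x_1,\ldots,x_n]$, $q(D)=\sum_\alpha q_\alpha D^\alpha$ is the corresponding constant-coefficient partial differential operator. Thus $[D^\alpha p](D)$ is the operator given by the polynomial $D^\alpha p$, and $[D^\alpha p](D)g(x)$ is the value at the point $x$ of the polynomial obtained by applying this operator to $g$. For $x\in k^n$, define the $k$-linear space $$D_x(\mathcal G):=\{p\in k[x_1,\ldots,x_n] : [D^\alpha p](D)g_i(x)=0,\ i=1,\ldots,n,\ \text{for all }\alpha\in\mathbb Z_+^n\},$$ and the intersection multiplicity $I_x(\mathcal G):=\dim_k D_x(\mathcal G)\in\{0,1,2,\ldots\}\cup\{\infty\}$. The sum over $x\in k^n$ is taken in $\{0,1,2,\ldots\}\cup\{\infty\}$. ''No intersection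 at infinity'' means that the homogeneous components of top degree of $g_1,\ldots,g_n$ (the component of $g_i$ of degree $\deg(g_i)$) have no common zero in $k^n\setminus\{0\}$. *)

(* Defs.v *)
From HB Require Import structures.
From mathcomp Require Import all_boot all_order all_algebra.
(* Importing mpoly after the classical/analysis files makes notations clash. *)
From mathcomp Require Import mpoly.
From mathcomp Require Import boolp classical_sets constructive_ereal reals.
From mathcomp Require Import ereal esum.

Set Implicit Arguments.
Unset Strict Implicit.
Unset Printing Implicit Defensive.

Import GRing.Theory.

Local Open Scope classical_set_scope.
Local Open Scope ring_scope.

Section Dimension.
Context {K : fieldType} {V : lmodType K}.

Definition linearly_independent d (b : 'I_d -> V) : Prop :=
  forall c : 'I_d -> K, \sum_i c i *: b i = 0 -> forall i, c i = 0.

Definition linear_span d (b : 'I_d -> V) : set V :=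
  [set v | exists c : 'I_d -> K, v = \sum_i c i *: b i].

Definition is_basis (U : set V) d (b : 'I_d -> V) : Prop :=
  linearly_independent b /\ linear_span b = U.

(* Any two finite bases of U have the same size, so the infimum is that of a
   singleton if U has a finite basis, and of the empty set, that is +oo,
   otherwise. Extended natural numbers are taken inside \bar R. *)
Definition dimension (R : realType) (U : set V) : \bar R :=
  ereal_inf [set d%:R%:E | d in [set d | exists b : 'I_d -> V, is_basis U b]].

End Dimension.

Section Multiplicity.
Context {k : fieldType} {n : nat}.
Implicit Types (p q f : {mpoly k[n]}) (x : 'rV[k]_n).

(* q(D) f; the notation f^`M[m] is D^m f. *)
Definition diffop q f : {mpoly k[n]} :=
  \sum_(m <- msupp q) q@_m *: f^`M[m].

Definition dual_space (g : 'I_n -> {mpoly k[n]}) x : set {mpoly k[n]} :=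
  [set p | forall (i : 'I_n) (m : 'X_{1..n}),
     (diffop p^`M[m] (g i)).@[x 0] = 0].

Definition multiplicity (R : realType) (g : 'I_n -> {mpoly k[n]}) x : \bar R :=
  dimension R (dual_space g x).

(* msize p is 1 + the total degree of p when p != 0. *)
Definition deg p : nat := (msize p).-1.

Definition top_component p : {mpoly k[n]} := pihomog mdeg (deg p) p.

Definition no_intersection_at_infinity (g : 'I_n -> {mpoly k[n]}) : Prop :=
  ~ exists y : 'rV[k]_n,
      y != 0 /\ forall i, (top_component (g i)).@[y 0] = 0.

End Multiplicity.

(* Main.v *)
From HB Require Import structures.
Require Import Defs.
From mathcomp Require Import all_boot all_order all_algebra.
From mathcomp Require Import mpoly.
From mathcomp Require Import boolp classical_sets constructive_ereal reals.
From mathcomp Require Import ereal esum.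
From mathcomp Require Import cardinality fsbigop zify ring.

(** The proof distinguishes two cases by the characteristic of [k].

    In characteristic [q > 0] with [n > 0], the operators [D_i ^ (q j)] with [j > 0] and
    the derivatives of [X_i ^ (q j)] are zero, so these monomials lie in every dual
    space and every multiplicity is infinite ([dimension_dual_space_pchar]).

    In the remaining case all factorials of exponents are invertible in [k], and the sum
    is the dimension of the quotient [Q] of the polynomial ring by the ideal of the
    [g i]. Leibniz' rule turns the conditions on the derivatives of [p] into
    the vanishing of [p(D)] at [x] on the whole ideal ([dual_spaceE]). Thus [p]
    gives a linear form on [Q], on which the transpose of multiplication by [X_i - x_i]
    acts as the derivative of [p], hence nilpotently. Conversely a linear form killed
    by powers of these operators comes from exactly one [p], with coefficients read off
    from monomials in the [X_i - x_i]. The dual space at [x] is therefore a joint generalized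
    eigenspace of commuting operators on the dual of [Q], and the
    dimensions of these eigenspaces add up to that of [Q] ([inverse_system_count]).

    The dimension of [Q] is the product of the degrees. For forms with the
    origin as their only common zero this is [bezout_forms]. It rests on an exchange
    argument ([regular_exchange]): when [(s, a)] is a regular sequence and [(s, a)],
    [(s, b)] both have only the origin as zero, [(s, b)] is regular too, and the
    colengths are in the ratio of the degrees of [a] and [b]; this is seen on the
    Hilbert function modulo [s], which is eventually periodic. The sequence of the
    variables, of colength one, is exchanged step by step for the given
    forms through generic linear forms ([regular_exchange_all]); these exist because
    the projective zeros of [s] are finite in number. That a homogeneous ideal with no
    zero but the origin contains all forms of high degree is the
    projective Nullstellensatz ([projective_nullstellensatz]). Finally, regularity of the
    top components implies that they generate the ideal of top components
    of the ideal of the [g i] ([in_ideal_top_component]), so that both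
    quotients have the same dimension. *)

Set Implicit Arguments.
Unset Strict Implicit.
Unset Printing Implicit Defensive.

Import GRing.Theory.

Local Open Scope ring_scope.
Local Notation component := (pihomog mdeg).

(** * Ideals given by generators, and regular sequences *)

Section GeneratedIdeal.
Context {A : comNzRingType}.
Implicit Types (s : seq A) (a b c u v w : A).

Fixpoint in_ideal s u : Prop :=
  if s is a :: s' then exists c, in_ideal s' (u - c * a) else u = 0.

Lemma in_ideal0 s : in_ideal s 0.
Proof. by elim: s => //= a s IH; exists 0; rewrite mul0r subr0. Qed.

Lemma in_idealD s u v : in_ideal s u -> in_ideal s v -> in_ideal s (u + v).
Proof.
elim: s u v => [u v -> ->|a s IH u v /= [c Hc] [d Hd]] /=; first by rewrite addr0.
by exists (c + d); rewrite mulrDl opprD addrACA; apply: IH.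
Qed.

Lemma in_idealMl s w u : in_ideal s u -> in_ideal s (w * u).
Proof.
elim: s u => [u ->|a s IH u /= [c Hc]] /=; first by rewrite mulr0.
by exists (w * c); rewrite -mulrA -mulrBr; apply: IH.
Qed.

Lemma in_idealN s u : in_ideal s u -> in_ideal s (- u).
Proof. by rewrite -mulN1r; apply: in_idealMl. Qed.

Lemma in_idealB s u v : in_ideal s u -> in_ideal s v -> in_ideal s (u - v).
Proof. by move=> Hu Hv; apply: in_idealD => //; apply: in_idealN. Qed.

Lemma in_ideal_sum s (I : Type) (r : seq I) (P : pred I) (F : I -> A) :
  (forall i, P i -> in_ideal s (F i)) -> in_ideal s (\sum_(i <- r | P i) F i).
Proof.
move=> HF; elim/big_rec: _ => [|i u Pi]; first exact: in_ideal0.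
by apply: in_idealD; apply: HF.
Qed.

Lemma in_ideal_subr s u v : in_ideal s (u - v) -> in_ideal s v -> in_ideal s u.
Proof. by move=> Huv Hv; rewrite -(subrK v u); apply: in_idealD. Qed.

Lemma in_ideal_subl s u v : in_ideal s (u - v) -> in_ideal s u -> in_ideal s v.
Proof. by move=> Huv Hu; rewrite -(subKr u v); apply: in_idealB. Qed.

Lemma in_ideal_cons a s u : in_ideal s u -> in_ideal (a :: s) u.
Proof. by exists 0; rewrite mul0r subr0. Qed.

Lemma in_ideal_consP a s u c :
  in_ideal s (u - c * a) -> in_ideal (a :: s) u.
Proof. by exists c. Qed.

Lemma in_ideal_mem s a : a \in s -> in_ideal s a.
Proof.
elim: s => //= b s IH; rewrite inE => /orP[/eqP ->|/IH Ha].
  by exists 1; rewrite mul1r subrr; apply: in_ideal0.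
exact: (@in_ideal_cons b).
Qed.

Lemma in_ideal_gen s s' u :
  (forall a, a \in s -> in_ideal s' a) -> in_ideal s u -> in_ideal s' u.
Proof.
elim: s u => [u _ ->|a s IH u Hs [c Hc]]; first exact: in_ideal0.
apply: (@in_ideal_subr _ _ (c * a)).
  by apply: IH => // b bs; apply: Hs; rewrite inE bs orbT.
by apply/in_idealMl/Hs; rewrite inE eqxx.
Qed.

Lemma in_ideal_sub s s' u : {subset s <= s'} -> in_ideal s u -> in_ideal s' u.
Proof. by move=> ss'; apply: in_ideal_gen => a /ss'; apply: in_ideal_mem. Qed.

(** If [1 = c * a] modulo [s], then [b = c * (a * b)] modulo [s]. *)
Lemma in_ideal_cancel a b s :
  in_ideal (a :: s) 1 -> in_ideal s (a * b) -> in_ideal s b.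
Proof.
move=> [c Hc] Hab; rewrite -[b]mulr1 -(subrK (c * a) 1) mulrDr.
apply: in_idealD; first exact: in_idealMl.
by rewrite mulrCA (mulrC b); apply: in_idealMl.
Qed.

Definition nonzerodivisor s a := forall u, in_ideal s (u * a) -> in_ideal s u.

(** A regular sequence is listed from its last element to its first. *)
Fixpoint regular s : Prop :=
  if s is a :: s' then regular s' /\ nonzerodivisor s' a else True.

Lemma nonzerodivisor_exp s a m :
  nonzerodivisor s a -> nonzerodivisor s (a ^+ m).
Proof.
move=> Ha; elim: m => [|m IH] u; first by rewrite expr0 mulr1.
by rewrite exprSr mulrA => /Ha /IH.
Qed.

Lemma nonzerodivisor_sub s s' a : s =i s' ->
  nonzerodivisor s a -> nonzerodivisor s' a.
Proof.
move=> ss' Ha u Hu; apply: (@in_ideal_sub s); first by move=> b; rewrite ss'.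
by apply: Ha; apply: in_ideal_sub Hu => b; rewrite ss'.
Qed.

(** If [u * a = v * b] modulo [s], then [v] is a multiple [w * a] since [b] is regular
    modulo [a], and cancelling [a] gives [u = w * b]. *)
Lemma nonzerodivisor_swap s a b : nonzerodivisor s a ->
  nonzerodivisor (a :: s) b -> nonzerodivisor (b :: s) a.
Proof.
move=> Ha Hb u [v Hv].
have [w Hw] : in_ideal (a :: s) v.
  apply: Hb; exists u; rewrite -opprB; exact: in_idealN.
exists w; apply: Ha.
apply: (@in_ideal_subr _ _ ((v - w * a) * b)); last by rewrite mulrC; apply: in_idealMl.
suff -> : (u - w * b) * a - (v - w * a) * b = u * a - v * b by [].
by ring.
Qed.

End GeneratedIdeal.

(** * Homogeneous ideals *)

Section HomogeneousIdeal.
Context {k : fieldType} {n : nat}.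
Local Notation A := {mpoly k[n]}.
Implicit Types (s : seq A) (a b c u v w : A) (t d m : nat).

Definition homogeneous a := a \is (deg a).-homog.

(** The zero polynomial is excluded, since [deg 0 = 0]. *)
Definition is_form a := homogeneous a && (0 < deg a)%N.

Lemma homogeneous_homog d a : a \is d.-homog -> homogeneous a.
Proof. exact: dhomog_msize. Qed.

Lemma deg_homog d a : a != 0 -> a \is d.-homog -> deg a = d.
Proof. by move=> a0 Ha; apply: (dhomog_uniq a0 (homogeneous_homog Ha) Ha). Qed.

Lemma is_form_homogeneous a : is_form a -> homogeneous a.
Proof. by case/andP. Qed.

Lemma all_form_homogeneous s : all is_form s -> all homogeneous s.
Proof. by apply: sub_all => a /is_form_homogeneous. Qed.

Lemma mpoly_components u : u = \sum_(t < msize u) component t u.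
Proof. exact: pihomog_partitionE. Qed.

Lemma component_homog t u : u \is t.-homog -> component t u = u.
Proof. exact: pihomog_dE. Qed.

Lemma component_ge t u : (msize u <= t)%N -> component t u = 0.
Proof.
move=> ut; rewrite [u]mpoly_components linear_sum big1 // => i _.
by apply: (@pihomog_ne0 _ _ _ i); [rewrite neq_ltn (leq_trans (ltn_ord i)) | apply: pihomogP].
Qed.

Lemma msize_homog t u : u \is t.-homog -> (msize u <= t.+1)%N.
Proof.
move=> /dhomogP Hu; rewrite mmeasureE; apply/bigmax_leqP_seq => m mu _.
by rewrite ltnS (Hu m mu).
Qed.

Lemma msize_le_component t u :
  (msize u <= t.+1)%N -> component t u = 0 -> (msize u <= t)%N.
Proof.
move=> ut u0; rewrite mmeasureE; apply/bigmax_leqP_seq => m mu _.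
have := leq_trans (msize_mdeg_lt mu) ut; rewrite ltnS leq_eqVlt => /orP[/eqP umt|//].
move: mu; rewrite mcoeff_msupp => /negP[]; move: u0.
rewrite (pihomogwE _ _ ut) => /(congr1 (mcoeff m)); rewrite mcoeff0 => <-.
have mt' : (mdeg m < t.+1)%N by rewrite umt.
rewrite linear_sum /= (bigD1 (BMultinom mt')) ?umt //= mcoeffZ mcoeffX eqxx mulr1.
rewrite big1 ?addr0 // => i /andP[_ im]; rewrite mcoeffZ mcoeffX.
by case: eqP => [e|]; rewrite ?mulr0 //; case/eqP: im; apply/val_inj.
Qed.

Lemma componentMr t d a c :
  a \is d.-homog -> component (t + d) (c * a) = component t c * a.
Proof.
move=> Ha; rewrite {1}[c]mpoly_components mulr_suml linear_sum /=.
transitivity (\sum_(i < msize c) if (i == t :> nat) then component t c * a else 0).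
  apply: eq_bigr => i _; have Hi := dhomogM (pihomogP mdeg i c) Ha.
  case: eqP => [<-|/eqP it]; first by rewrite component_homog.
  by apply: pihomog_ne0 Hi; rewrite eqn_add2r.
have [ct|tc] := leqP (msize c) t.
  rewrite (component_ge ct) mul0r big1 // => i _; by case: ifP.
rewrite (bigD1 (Ordinal tc)) //= eqxx big1 ?addr0 // => i it; case: eqP => // e.
by case/eqP: it; apply/val_inj.
Qed.

Lemma componentMr_lt t d a c :
  a \is d.-homog -> (t < d)%N -> component t (c * a) = 0.
Proof.
move=> Ha td; rewrite {1}[c]mpoly_components mulr_suml linear_sum big1 //= => i _.
apply: (@pihomog_ne0 _ _ _ (i + d)%N); last exact: dhomogM (pihomogP _ _ _) Ha.
by rewrite neq_ltn ltn_addl ?orbT.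
Qed.

Lemma in_ideal_component s t u :
  all homogeneous s -> in_ideal s u -> in_ideal s (component t u).
Proof.
elim: s u => [u _ ->|a s IH u /= /andP[Ha Hs] [c /(IH _ Hs)]]; first exact: raddf0.
rewrite linearB /=; have [td|dt] := ltnP t (deg a).
  by rewrite (componentMr_lt _ Ha) // subr0; apply: in_ideal_cons.
rewrite -{2}(subnK dt) (componentMr _ _ Ha); exact: in_ideal_consP.
Qed.

Lemma in_ideal_components s u : (forall t, in_ideal s (component t u)) -> in_ideal s u.
Proof.
by move=> Hu; rewrite [u]mpoly_components; apply: in_ideal_sum => t _; apply: Hu.
Qed.

Lemma in_ideal_cons_homog a s t u : homogeneous a -> all homogeneous s ->
  u \is (t + deg a).-homog -> in_ideal (a :: s) u ->
  exists2 c, c \is t.-homog & in_ideal s (u - c * a).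
Proof.
move=> Ha Hs Hu [c /(in_ideal_component (t + deg a) Hs)].
rewrite linearB /= (componentMr _ _ Ha) component_homog // => Hc.
by exists (component t c) => //; apply: pihomogP.
Qed.

Lemma in_ideal_cons_homog_lt a s t u : homogeneous a -> all homogeneous s ->
  u \is t.-homog -> (t < deg a)%N -> in_ideal (a :: s) u -> in_ideal s u.
Proof.
move=> Ha Hs Hu td [c /(in_ideal_component t Hs)].
by rewrite linearB /= (componentMr_lt _ Ha) // subr0 component_homog.
Qed.

Lemma nonzerodivisor_homog s a : all homogeneous s -> homogeneous a ->
  (forall t u, u \is t.-homog -> in_ideal s (u * a) -> in_ideal s u) ->
  nonzerodivisor s a.
Proof.
move=> Hs Ha H u Hu; apply: in_ideal_components => t.
apply: (H t); first exact: pihomogP.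
by rewrite -(componentMr _ _ Ha); apply: in_ideal_component.
Qed.

(** If [u * b] lies in the ideal, then so does [w * b] for some [w] with
    [u = w * a] modulo the ideal. Since [a] has positive degree, [w] has smaller
    degree than [u], and the descent ends. *)
Lemma nonzerodivisor_drop s a b : all homogeneous s -> is_form a -> homogeneous b ->
  nonzerodivisor s a -> nonzerodivisor (a :: s) b -> nonzerodivisor s b.
Proof.
move=> Hs /andP[Ha a_gt0] Hb nza nzb; apply: nonzerodivisor_homog => // t.
elim/ltn_ind: t => t IH u Hu Hub.
have Hau : in_ideal (a :: s) u by apply: nzb; apply: in_ideal_cons.
have [td|dt] := ltnP t (deg a); first exact: (in_ideal_cons_homog_lt Ha Hs Hu td).
rewrite -(subnK dt) in Hu.
have [w Hw Huw] := in_ideal_cons_homog Ha Hs Hu Hau.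
apply: (in_ideal_subr Huw); rewrite mulrC; apply: in_idealMl.
have lt_t : (t - deg a < t)%N by rewrite ltn_subrL a_gt0 (leq_trans a_gt0).
apply: (IH _ lt_t _ Hw).
apply: nza; rewrite mulrAC; apply: (in_ideal_subl _ Hub).
by rewrite -mulrBl mulrC; apply: in_idealMl.
Qed.

Lemma regular_swap a b s : all homogeneous s -> homogeneous b -> is_form a ->
  regular (b :: a :: s) -> regular (a :: b :: s).
Proof.
move=> Hs Hb Ha [[rs nza] nzb]; split; last exact: nonzerodivisor_swap nzb.
by split=> //; apply: nonzerodivisor_drop nzb.
Qed.

Lemma regular_front a s1 s2 : all is_form (s1 ++ a :: s2) ->
  regular (s1 ++ a :: s2) -> regular (a :: s1 ++ s2).
Proof.
elim: s1 => //= b s1 IH /andP[Hb Hs] [rs nzb].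
have := Hs; rewrite all_cat /= => /and3P[H1 Ha H2].
apply: regular_swap => //; first by rewrite all_form_homogeneous // all_cat H1.
  exact: is_form_homogeneous.
split; first exact: IH.
apply: nonzerodivisor_sub nzb => c; rewrite !(inE, mem_cat); exact: orbCA.
Qed.

Lemma regular_insert a s1 s2 : all is_form (s1 ++ a :: s2) ->
  regular (a :: s1 ++ s2) -> regular (s1 ++ a :: s2).
Proof.
elim: s1 => //= b s1 IH /andP[Hb Hs] r; have := Hs.
rewrite all_cat /= => /and3P[H1 Ha H2].
have [rs nzb] : regular (b :: a :: s1 ++ s2).
  apply: regular_swap => //; first by rewrite all_form_homogeneous // all_cat H1.
  exact: is_form_homogeneous.
split; first exact: IH.
apply: nonzerodivisor_sub nzb => c; rewrite !(inE, mem_cat); exact: orbCA.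
Qed.

(** For homogeneous [s]: the ideal contains a power of the irrelevant ideal. *)
Definition irrelevant s :=
  exists T, forall t u, (T <= t)%N -> u \is t.-homog -> in_ideal s u.

Lemma irrelevant_gen s s' :
  (forall a, a \in s -> in_ideal s' a) -> irrelevant s -> irrelevant s'.
Proof.
move=> ss' [T HT]; exists T => t u Tt Hu.
by apply: in_ideal_gen ss' _; apply: HT Hu.
Qed.

Lemma irrelevant_sub s s' : {subset s <= s'} -> irrelevant s -> irrelevant s'.
Proof. by move=> ss'; apply: irrelevant_gen => a /ss'; apply: in_ideal_mem. Qed.

End HomogeneousIdeal.

(** * The Nullstellensatz *)

Section LinearDependence.
Context {k : fieldType}.

Lemma dependent_rows N M (F : 'I_M -> 'rV[k]_N) : (N < M)%N ->
  exists2 c : 'rV[k]_M, c != 0 & \sum_i c 0 i *: F i = 0.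
Proof.
move=> NM; pose B := \matrix_(i, j) F i 0 j.
have /rowV0Pn[c /sub_kermxP cB c0] : kermx B != 0.
  rewrite -mxrank_eq0 mxrank_ker; have := rank_leq_col B; lia.
exists c => //; apply/rowP => j; rewrite summxE mxE.
move/rowP/(_ j): cB; rewrite !mxE => cB; rewrite -[RHS]cB.
by apply: eq_bigr => i _; rewrite !mxE.
Qed.

End LinearDependence.

Section FiniteCodimension.
Context {k : closedFieldType} {n : nat}.
Local Notation A := {mpoly k[n]}.
Implicit Types (s : seq A) (a b c l u v w : A) (t d m : nat) (y : 'rV[k]_n).

(** The quotient by the ideal of [s] is a finite dimensional vector space. *)
Definition cofinite s :=
  exists T, forall u, exists2 v, (msize v <= T)%N & in_ideal s (u - v).

Definition vanishes s y := forall a, a \in s -> a.@[y 0] = 0.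

Lemma in_ideal_vanishes s u y : vanishes s y -> in_ideal s u -> u.@[y 0] = 0.
Proof.
elim: s u => [u _ ->|a s IH u Hy [c Hc]]; first exact: meval0.
have /IH/(_ Hc) : vanishes s y by move=> b bs; apply: Hy; rewrite inE bs orbT.
by rewrite mevalB mevalM (Hy a) ?inE ?eqxx // mulr0 subr0.
Qed.

Lemma cofinite_gen s s' :
  (forall a, a \in s -> in_ideal s' a) -> cofinite s -> cofinite s'.
Proof.
move=> ss' [T HT]; exists T => u; have [v vT Hv] := HT u; exists v => //.
exact: in_ideal_gen Hv.
Qed.

(** The powers of [w] are congruent to polynomials in a finite dimensional
    space, so finitely many of them are linearly dependent. *)
Lemma cofinite_algebraic s w : cofinite s ->
  exists2 P : {poly k}, P != 0 & in_ideal s (map_poly (@mpolyC n k) P).[w].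
Proof.
move=> [T HT].
have /choice[v Hv] : forall i : nat, exists v, (msize v <= T)%N /\ in_ideal s (w ^+ i - v).
  by move=> i; have [v ? ?] := HT (w ^+ i); exists v.
pose N := #|{: 'X_{1..n < T}}|.
pose mon (j : 'I_N) : 'X_{1..n} := bmnm (enum_val j : 'X_{1..n < T}).
have [c c0 Hc] := @dependent_rows k N N.+1
  (fun i => \row_j (v i)@_(mon j)) (leqnn _).
exists (\poly_(i < N.+1) c 0 (inord i)).
  apply: contra c0 => /eqP /polyP P0; apply/eqP/rowP => i.
  by have := P0 i; rewrite coef_poly ltn_ord inord_val coef0 mxE.
have -> : (map_poly (@mpolyC n k) (\poly_(i < N.+1) c 0 (inord i))).[w] =
    \sum_(i < N.+1) c 0 i *: w ^+ i.
  rewrite (@horner_coef_wide _ N.+1); last first.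
    by rewrite /map_poly (leq_trans (size_poly _ _)) // size_poly.
  apply: eq_bigr => i _; rewrite coef_map coef_poly ltn_ord inord_val.
  by rewrite mul_mpolyC.
suff -> : \sum_(i < N.+1) c 0 i *: w ^+ i = \sum_(i < N.+1) c 0 i *: (w ^+ i - v i).
  apply: in_ideal_sum => i _; rewrite -mul_mpolyC; apply: in_idealMl.
  by case: (Hv i).
apply/esym/eqP; under eq_bigr => i _ do rewrite scalerBr.
rewrite sumrB subr_eq -subr_eq0 opprD addNKr oppr_eq0; apply/eqP/mpolyP => m.
rewrite mcoeff0 linear_sum /=; have [mT|Tm] := ltnP (mdeg m) T.
  move/rowP/(_ (enum_rank (BMultinom mT))): Hc; rewrite summxE mxE => Hc.
  rewrite -[RHS]Hc; apply: eq_bigr => i _; rewrite !mxE mcoeffZ.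
  by rewrite /mon enum_rankK.
apply: big1 => i _; rewrite mcoeffZ memN_msupp_eq0 ?mulr0 //.
by apply: msize_mdeg_ge; apply: leq_trans Tm; case: (Hv i).
Qed.

(** If every [w - z] generated the unit ideal together with [s], the roots of a
    polynomial relation for [w] could be cancelled one after another. *)
Lemma cofinite_specialize s w : cofinite s -> ~ in_ideal s 1 ->
  exists z : k, ~ in_ideal ((w - z%:MP) :: s) 1.
Proof.
move=> /(cofinite_algebraic w)[P P0]; have [r Pr] := closed_field_poly_normal P.
rewrite {}Pr map_polyZ /= hornerZ rmorph_prod /= horner_prod => Hr s1.
apply: contrapT => /forallNP /= H; apply: s1.
have {Hr} : in_ideal s (\prod_(z <- r) (w - z%:MP)).
  have lP : lead_coef P != 0 by rewrite lead_coef_eq0.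
  move/(in_idealMl (lead_coef P)^-1%:MP): Hr; rewrite mulrA -mpolyCM mulVf // mul1r.
  congr (in_ideal s _); apply: eq_bigr => z _.
  by rewrite rmorphB /= map_polyX map_polyC /= hornerXsubC.
elim: r => [|z r IH]; first by rewrite big_nil.
rewrite big_cons => Hr; apply: IH; apply: in_ideal_cancel Hr.
exact: (contrapT (H z)).
Qed.

Lemma in_ideal_eval s (z : 'I_n -> k) u :
  (forall i, in_ideal s ('X_i - (z i)%:MP)) -> in_ideal s (u - (u.@[z])%:MP).
Proof.
move=> Hz.
pose Q u := in_ideal s (u - (u.@[z])%:MP).
have QM u1 u2 : Q u1 -> Q u2 -> Q (u1 * u2).
  rewrite /Q => H1 H2; rewrite mevalM mpolyCM.
  have -> : u1 * u2 - (u1.@[z])%:MP * (u2.@[z])%:MP =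
     u2 * (u1 - (u1.@[z])%:MP) + (u1.@[z])%:MP * (u2 - (u2.@[z])%:MP) by ring.
  by apply: in_idealD; apply: in_idealMl.
have QC (x : k) : Q x%:MP by rewrite /Q mevalC subrr; apply: in_ideal0.
have QX i : Q 'X_i by rewrite /Q mevalXU; apply: Hz.
rewrite -/(Q u) [u]mpolyE; elim/big_rec: _ => [|m v _ Qv].
  by rewrite -[0]mpolyC0.
have Qm : Q (u@_m *: 'X_[m]).
  rewrite -mul_mpolyC; apply: (QM) => //; rewrite mpolyXE_id.
  elim/big_rec: _ => [|i w _ Qw]; first by rewrite -[1]mpolyC1.
  apply: (QM) => //; elim: (m i) => [|j IH]; first by rewrite expr0 -[1]mpolyC1.
  by rewrite exprS; apply: (QM).
by rewrite /Q mevalD mpolyCD opprD addrACA; apply: in_idealD.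
Qed.

(** One coordinate at a time, a value is chosen that keeps the ideal proper. *)
Lemma nullstellensatz_cofinite s :
  cofinite s -> ~ in_ideal s 1 -> exists y, vanishes s y.
Proof.
move=> sfin s1.
have [s' [ss' s'fin s'1 Hs']] : exists s', [/\ forall a, a \in s -> in_ideal s' a,
    cofinite s', ~ in_ideal s' 1 &
    forall i, i \in enum 'I_n -> exists z, in_ideal s' ('X_i - z%:MP)].
  elim: (enum 'I_n) => [|i r [s' [ss' s'fin s'1 Hs']]].
    by exists s; split=> // a; apply: in_ideal_mem.
  have [z Hz] := cofinite_specialize 'X_i s'fin s'1.
  exists (('X_i - z%:MP) :: s'); split => //.
  - by move=> a /ss' /in_ideal_cons.
  - by apply: cofinite_gen s'fin => a as'; apply/in_ideal_cons/in_ideal_mem.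
  - move=> j; rewrite inE => /orP[/eqP ->|/Hs'[x Hx]].
      by exists z; apply: in_ideal_mem; rewrite inE eqxx.
    by exists x; apply: in_ideal_cons.
have /choice[z Hz] i : exists z, in_ideal s' ('X_i - z%:MP).
  by apply: Hs'; rewrite mem_enum.
exists (\row_i z i) => a /ss' Ha; apply: contrapT => /eqP az.
apply: s'1; rewrite -[1]mpolyC1 -(mulVf az) mpolyCM; apply: in_idealMl.
have -> : a.@[(\row_i z i) 0] = a.@[z] by apply: meval_eq => i; rewrite mxE.
exact: in_ideal_subl (in_ideal_eval a Hz) Ha.
Qed.

(** Every coordinate of a zero is a root of a fixed nonzero polynomial. *)
Lemma cofinite_finite_zeros s : cofinite s ->
  exists pts : seq 'rV[k]_n, forall y, vanishes s y -> y \in pts.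
Proof.
move=> sfin.
have /choice[r Hr] i : exists r : seq k, forall y, vanishes s y -> y 0 i \in r.
  have [P P0] := cofinite_algebraic 'X_i sfin; have [r Pr] := closed_field_poly_normal P.
  move=> HP; exists r => y /in_ideal_vanishes /(_ HP).
  move: P0; rewrite Pr scaler_eq0 negb_or map_polyZ /= hornerZ mevalM mevalC.
  case/andP=> l0 _ /eqP; rewrite mulf_eq0 (negPf l0) /= rmorph_prod /= horner_prod.
  rewrite rmorph_prod /= prodf_seq_eq0 => /hasP[z zr] /=.
  rewrite rmorphB /= map_polyX map_polyC /= hornerXsubC mevalB mevalXU mevalC.
  by rewrite subr_eq0 => /eqP ->.
pose R := flatten [seq r i | i <- enum 'I_n].
have Ry y : vanishes s y -> forall i, y 0 i \in R.
  by move=> Hy i; apply/flatten_mapP; exists i; rewrite ?mem_enum //; apply: Hr.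
exists [seq \row_i val (f i) | f : {ffun 'I_n -> seq_sub R}] => y /Ry Hy.
have -> : y = \row_i val ([ffun i => SeqSub (Hy i)] i).
  by apply/rowP => i; rewrite mxE ffunE.
exact: (map_f (fun f : {ffun 'I_n -> seq_sub R} => \row_i val (f i)) (mem_enum _ _)).
Qed.

(** In high degree every form is a multiple of [l] modulo [s], and imposing
    [l = 1] lowers its degree. *)
Lemma irrelevant_cofinite l s : is_form l -> all homogeneous s ->
  irrelevant (l :: s) -> cofinite ((l - 1) :: s).
Proof.
move=> /andP[Hl l_gt0] Hs [T HT]; exists T.
have H t u : u \is t.-homog ->
    exists2 v, (msize v <= T)%N & in_ideal ((l - 1) :: s) (u - v).
  elim/ltn_ind: t u => t IH u Hu; have [tT|Tt] := ltnP t T.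
    exists u; first exact: leq_trans (msize_homog Hu) tT.
    by rewrite subrr; apply: in_ideal0.
  have [tl|lt] := ltnP t (deg l).
    exists 0; first by rewrite mmeasure0.
    rewrite subr0; apply: in_ideal_cons.
    exact: (in_ideal_cons_homog_lt Hl Hs Hu tl (HT _ _ Tt Hu)).
  have Hu' : u \is (t - deg l + deg l).-homog by rewrite subnK.
  have [c Hc Huc] := in_ideal_cons_homog Hl Hs Hu' (HT _ _ Tt Hu).
  have lt_t : (t - deg l < t)%N by rewrite ltn_subrL l_gt0 (leq_trans l_gt0).
  have [v vT Hv] := IH _ lt_t _ Hc; exists v => //.
  rewrite -(subrK c u) -addrA; apply: in_idealD => //.
  apply: (@in_ideal_consP _ _ _ _ c).
  by rewrite mulrBr mulr1 opprB addrA subrK.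
move=> u; rewrite [u]mpoly_components; elim/big_rec: _ => [|t w _ [v vT Hv]].
  by exists 0; rewrite ?mmeasure0 // subrr; apply: in_ideal0.
have [v' v'T Hv'] := H t _ (pihomogP _ _ _ : component t u \is t.-homog).
exists (v' + v); first by rewrite (leq_trans (msizeD_le _ _)) // geq_max v'T.
by rewrite opprD addrACA; apply: in_idealD.
Qed.

(** If [c * (l - 1) = 1] modulo [s], a comparison of components shows that modulo [s]
    the powers of [l] are components of [- c], almost all of which vanish. *)
Lemma in_ideal_power l s : is_form l -> all homogeneous s ->
  in_ideal ((l - 1) :: s) 1 -> exists m, in_ideal s (l ^+ m).
Proof.
move=> /andP[Hl l_gt0] Hs [c].
rewrite mulrBr mulr1 opprB addrA => Hc.
have H m : in_ideal s (l ^+ m + component (m * deg l) c).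
  elim: m => [|m IH].
    have := in_ideal_component 0 Hs Hc.
    rewrite linearB linearD /= (componentMr_lt _ Hl) // subr0.
    by rewrite component_homog ?expr0 ?mul0n ?dhomog1.
  have := in_ideal_component (m * deg l + deg l) Hs Hc.
  rewrite linearB linearD /= (componentMr _ _ Hl).
  have dm : 0%N != (m * deg l + deg l)%N by rewrite neq_ltn; lia.
  rewrite (pihomog_ne0 dm (dhomog1 _ _)) add0r mulSn addnC exprS => Hm.
  have -> : l * l ^+ m + component (deg l + m * deg l) c =
     l * (l ^+ m + component (m * deg l) c) +
     (component (deg l + m * deg l) c - component (m * deg l) c * l) by ring.
  by apply: in_idealD; first exact: in_idealMl.
exists (msize c); have := H (msize c).
by rewrite component_ge ?addr0 // leq_pmulr.
Qed.

Lemma irrelevant_power l s m : is_form l -> all homogeneous s ->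
  irrelevant (l :: s) -> in_ideal s (l ^+ m) -> irrelevant s.
Proof.
move=> /andP[Hl l_gt0] Hs [T HT] lm.
suff H j t u : (T + j * deg l <= t)%N -> u \is t.-homog ->
    exists v, in_ideal s (u - v * l ^+ j).
  exists (T + m * deg l)%N => t u Tt Hu; have [v Hv] := H _ _ _ Tt Hu.
  by apply: (in_ideal_subr Hv); apply: in_idealMl.
elim: j t u => [|j IH] t u Tt Hu; first by exists u; rewrite expr0 mulr1 subrr; apply: in_ideal0.
have Hu' : u \is (t - deg l + deg l).-homog by rewrite subnK //; lia.
have Tt' : (T <= t)%N by lia.
have [c Hc Huc] := in_ideal_cons_homog Hl Hs Hu' (HT _ _ Tt' Hu).
have [|v Hv] := IH _ _ _ Hc; first by lia.
exists v; rewrite -(subrK (c * l) u) -addrA; apply: in_idealD => //.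
rewrite exprSr mulrA -mulrBl mulrC; exact: in_idealMl.
Qed.

Lemma mdeg_gt0 (m : 'X_{1..n}) : (0 < mdeg m)%N -> exists i, (0 < m i)%N.
Proof.
move=> m0; apply/existsP; apply: contraTT m0 => /existsPn mi0; rewrite -leqNgt leqn0.
by rewrite mdegE big1 // => i _; apply/eqP; rewrite eqn0Ngt mi0.
Qed.

Lemma form_eval0 l : is_form l -> l.@[(0 : 'rV[k]_n) 0] = 0.
Proof.
case/andP=> /dhomogP Hl l_gt0; rewrite mevalE big_seq big1 // => m /Hl mdl.
have [i mi] : exists i, (0 < m i)%N by apply: mdeg_gt0; rewrite (mdl : mdeg m = _).
by rewrite (bigD1 i) //= mxE expr0n eqn0Ngt mi mul0r mulr0.
Qed.

(** If imposing [l = 1] on [s] is consistent, it yields a zero of [s], which is not the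
    origin because [l] has positive degree. Otherwise a power of [l] lies in the
    ideal, and forms of high degree are divisible by that power modulo [s]. *)
Lemma irrelevant_behead l s : is_form l -> all homogeneous s ->
  (forall y, vanishes s y -> y = 0) -> irrelevant (l :: s) -> irrelevant s.
Proof.
move=> Hl Hs s0 Hirr; have [H1|H1] := pselect (in_ideal ((l - 1) :: s) 1).
  by have [m Hm] := in_ideal_power Hl Hs H1; apply: irrelevant_power Hm.
have [y Hy] := nullstellensatz_cofinite (irrelevant_cofinite Hl Hs Hirr) H1.
have y0 : y = 0 by apply: s0 => a as_; apply: Hy; rewrite inE as_ orbT.
have := Hy _ (mem_head _ _); rewrite y0 mevalB meval1 form_eval0 // sub0r.
by move/eqP; rewrite oppr_eq0 oner_eq0.
Qed.

Lemma deg_mpolyX i : deg ('X_i : A) = 1%N.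
Proof. by rewrite /deg msizeX mdeg1. Qed.

Lemma is_form_mpolyX i : is_form ('X_i : A).
Proof. by rewrite /is_form /homogeneous deg_mpolyX dhomogX /= mdeg1. Qed.

Lemma in_ideal_variables (r : seq 'I_n) u :
  (forall m : 'X_{1..n}, m \in msupp u -> exists2 i, i \in r & (0 < m i)%N) ->
  in_ideal [seq 'X_i : A | i <- r] u.
Proof.
move=> Hu; rewrite [u]mpolyE big_seq; apply: in_ideal_sum => m /Hu[i ir mi].
rewrite -mul_mpolyC; apply: in_idealMl.
have -> : m = (m - U_(i) + U_(i))%MM by rewrite submK // lep1mP -lt0n.
by rewrite mpolyXD; apply/in_idealMl/in_ideal_mem/map_f.
Qed.

Lemma in_ideal_all_variables t u : (0 < t)%N -> u \is t.-homog ->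
  in_ideal [seq 'X_i : A | i <- enum 'I_n] u.
Proof.
move=> t_gt0 /dhomogP Hu; apply: in_ideal_variables => m /Hu mdt.
have [i mi] : exists i, (0 < m i)%N by apply: mdeg_gt0; rewrite (mdt : mdeg m = _).
by exists i; rewrite ?mem_enum.
Qed.

Lemma irrelevant_variables : irrelevant [seq 'X_i : A | i <- enum 'I_n].
Proof. by exists 1%N => t u; apply: in_ideal_all_variables. Qed.

(** The projective Nullstellensatz. The variables together generate an irrelevant
    ideal; they can be removed from the list of generators one at a time. *)
Theorem projective_nullstellensatz s : all homogeneous s ->
  (forall y, vanishes s y -> y = 0) -> irrelevant s.
Proof.
move=> Hs s0.
have : irrelevant ([seq 'X_i : A | i <- enum 'I_n] ++ s).
  by apply: irrelevant_sub irrelevant_variables => a; rewrite mem_cat => ->.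
elim: (enum 'I_n) => //= i r IH H; apply: IH; apply: irrelevant_behead H.
- exact: is_form_mpolyX.
- rewrite all_cat Hs andbT; apply/allP => _ /mapP[j _ ->].
  exact/is_form_homogeneous/is_form_mpolyX.
- by move=> y Hy; apply: s0 => a as_; apply: Hy; rewrite mem_cat as_ orbT.
Qed.

Lemma irrelevant_zero s y : irrelevant s -> vanishes s y -> y = 0.
Proof.
move=> [T HT] Hy; apply/rowP => i; rewrite mxE.
have /(in_ideal_vanishes Hy) : in_ideal s ('X_i ^+ T).
  apply: (HT T) => //; rewrite -[X in X.-homog]mul1n; apply: dhomogMn.
  by rewrite -(deg_mpolyX i); apply/is_form_homogeneous/is_form_mpolyX.
by rewrite rmorphXn /= mevalXU => /eqP; rewrite expf_eq0 => /andP[_ /eqP].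
Qed.

End FiniteCodimension.

(** * Hilbert functions and the exchange of regular elements *)

Lemma exists_vspace (k : fieldType) (V : vectType k) (P : V -> Prop) :
  P 0 -> (forall c u v, P u -> P v -> P (c *: u + v)) ->
  exists U : {vspace V}, forall v, v \in U <-> P v.
Proof.
move=> P0 PD.
pose inner (U : {vspace V}) := forall v, v \in U -> P v.
pose dims d := `[< exists2 U, inner U & \dim U = d >].
have ex_dims : exists d, dims d.
  by exists 0%N; apply/asboolP; exists 0%VS; rewrite ?dimv0 // => v; rewrite memv0 => /eqP ->.
have dims_le d : dims d -> (d <= \dim {:V})%N.
  by move/asboolP => [U _ <-]; apply/dimvS/subvf.
case: (ex_maxnP ex_dims dims_le) => d /asboolP[U PU Ud] maxU.
exists U => v; split=> [/PU //|Pv].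
have innerUv : inner (U + <[v]>)%VS.
  move=> _ /memv_addP[u /PU Pu [_ /vlineP[c ->] ->]].
  by rewrite addrC; apply: PD.
have /maxU : dims (\dim (U + <[v]>)) by apply/asboolP; exists (U + <[v]>)%VS.
rewrite -Ud => dUv; have/eqP-> : U == (U + <[v]>)%VS by rewrite eqEdim addvSl.
by apply: subvP (addvSr _ _) _ (memv_line v).
Qed.

Lemma sum_windows (h : nat -> nat) (a r T m : nat) :
  (forall t, (T <= t)%N -> (\sum_(i < a) h (t + i) = r)%N) ->
  (\sum_(i < m * a) h (T + i) = m * r)%N.
Proof.
move=> H; elim: m => [|m IH]; first by rewrite !mul0n big_ord0.
rewrite !mulSnr big_split_ord /= IH; congr addn.
under eq_bigr => i _ do rewrite addnA; rewrite H //; exact: leq_addr.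
Qed.

(** Two consecutive windows of length [a] have the same sum. *)
Lemma window_periodic (h : nat -> nat) (a r T m t : nat) :
  (forall t, (T <= t)%N -> (\sum_(i < a) h (t + i) = r)%N) ->
  (T <= t)%N -> h (t + m * a)%N = h t.
Proof.
move=> H; elim: m t => [|m IH] t Tt; first by rewrite addn0.
rewrite mulSnr addnA -[RHS](IH t) //.
have H1 := H (t + m * a)%N; have H2 := H (t + m * a).+1.
case: a H1 H2 {IH H} => [|a] H1 H2; first by rewrite !muln0 !addn0.
move: H1 H2; set t' := (t + m * a.+1)%N => H1 H2.
have Tt' : (T <= t')%N by rewrite /t'; lia.
have {}H1 : (h t' + \sum_(i < a) h (t' + i.+1) = r)%N.
  by rewrite -(H1 Tt') big_ord_recl /= addn0; congr addn; apply: eq_bigr.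
have {}H2 : (\sum_(i < a) h (t' + i.+1) + h (t' + a.+1) = r)%N.
  rewrite -(H2 (leqW Tt')) big_ord_recr /= addSnnS; congr addn.
  by apply: eq_bigr => i _; rewrite addSnnS.
lia.
Qed.

Section HilbertFunction.
Context {k : fieldType} {n : nat}.
Local Notation A := {mpoly k[n.+1]}.
Implicit Types (s : seq A) (a b : A) (t d m r : nat).

Lemma exists_ideal_part s t :
  exists U : {vspace dhomog n.+1 k t}, forall v, v \in U <-> in_ideal s (val v).
Proof.
apply: exists_vspace => [|c u v Hu Hv]; first exact: in_ideal0.
rewrite /= -mul_mpolyC; apply: in_idealD => //; exact: in_idealMl.
Qed.

Definition ideal_part s t : {vspace dhomog n.+1 k t} :=
  projT1 (cid (exists_ideal_part s t)).

Lemma ideal_partP s t v : v \in ideal_part s t <-> in_ideal s (val v).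
Proof. by rewrite /ideal_part; case: cid => /= U HU; apply: HU. Qed.

Definition hilbert s t : nat := \dim (ideal_part s t)^C.

Lemma hilbertE s t :
  (hilbert s t + \dim (ideal_part s t) = \dim {: dhomog n.+1 k t})%N.
Proof. by rewrite /hilbert dimv_compl subnK // dimvS ?subvf. Qed.

Lemma hilbert_congr s s' t :
  (forall u, u \is t.-homog -> in_ideal s u <-> in_ideal s' u) ->
  hilbert s t = hilbert s' t.
Proof.
move=> ss'; rewrite /hilbert; suff -> : ideal_part s t = ideal_part s' t by [].
have Hss (v : dhomog n.+1 k t) : in_ideal s (val v) <-> in_ideal s' (val v) by apply: ss'; apply: dhomog_is_dhomog.
apply/vspaceP => v; apply/idP/idP => /ideal_partP Hv; apply/ideal_partP; exact/Hss.
Qed.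

Lemma hilbert_eq0 s t :
  hilbert s t = 0%N <-> forall u, u \is t.-homog -> in_ideal s u.
Proof.
split=> [h0 u Hu|H].
  apply/(@ideal_partP _ _ (DHomog Hu)).
  suff -> : ideal_part s t = fullv by apply: memvf.
  by apply/eqP; rewrite eqEdim subvf -(hilbertE s) h0 add0n leqnn.
apply/eqP; rewrite -(eqn_add2r (\dim (ideal_part s t))) hilbertE add0n eq_sym.
suff -> : ideal_part s t = fullv by [].
by apply/vspaceP => v; rewrite memvf; apply/ideal_partP/H/dhomog_is_dhomog.
Qed.

Definition mul_dhomog t d a (Ha : a \is d.-homog) (v : dhomog n.+1 k t) :
  dhomog n.+1 k (t + d) := DHomog (dhomogM (dhomog_is_dhomog v) Ha).

Lemma mul_dhomog_is_linear t d a (Ha : a \is d.-homog) :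
  linear (@mul_dhomog t d a Ha).
Proof. by move=> c u v; apply/val_inj; rewrite /= mulrDl scalerAl. Qed.

HB.instance Definition _ t d a (Ha : a \is d.-homog) :=
  GRing.isLinear.Build k (dhomog n.+1 k t) (dhomog n.+1 k (t + d)) _
    (@mul_dhomog t d a Ha) (mul_dhomog_is_linear Ha).

(** The number [q] is the rank of multiplication by [a] from degree [t] of the
    quotient by [s] to degree [t + deg a]. *)
Lemma hilbert_cons s a t : all homogeneous s -> is_form a ->
  exists q, [/\ (q <= hilbert s t)%N,
    (hilbert (a :: s) (t + deg a) + q = hilbert s (t + deg a))%N &
    q = hilbert s t <->
    (forall u, u \is t.-homog -> in_ideal s (u * a) -> in_ideal s u)].
Proof.
move=> Hs /andP[Ha a_gt0].
have a0 : a != 0 by apply: contraTneq a_gt0 => ->; rewrite /deg mmeasure0.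
pose f := linfun (@mul_dhomog t (deg a) a Ha).
pose U := ideal_part s (t + deg a); pose W := (f @^-1: U)%VS.
have fE v : val (f v) = val v * a by rewrite lfunE.
have kerf : lker f == 0%VS.
  apply/lker0P => u v /(congr1 val); rewrite !fE => /(mulIf a0); exact: val_inj.
have WP v : v \in W <-> in_ideal s (val v * a).
  by rewrite -memv_preim -fE; apply: ideal_partP.
have sW : (ideal_part s t <= W)%VS.
  by apply/subvP => v /ideal_partP Hv; apply/WP; rewrite mulrC; apply: in_idealMl.
have dW : \dim (U :&: limg f) = \dim W.
  rewrite -(lpreimK (capvSr U (limg f))) lpreim_cap_limg.
  by rewrite limg_dim_eq // (eqP kerf) capv0.
have aU : ideal_part (a :: s) (t + deg a) = (U + limg f)%VS.
  apply/vspaceP => v; apply/idP/idP.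
    move/ideal_partP => Hv; have [c Hc Hvc] := in_ideal_cons_homog Ha Hs (dhomog_is_dhomog v) Hv.
    rewrite -(subrK (f (DHomog Hc)) v); apply: memv_add; last exact/memv_img/memvf.
    by apply/ideal_partP; rewrite linearB /= fE.
  case/memv_addP => u /ideal_partP Hu [_ /memv_imgP[w _ ->] ->].
  apply/ideal_partP; exists (val w); rewrite linearD /= fE.
  by rewrite addrK.
have := dimv_sum_cap U (limg f); rewrite -aU dW (@limg_dim_eq _ _ _ f) ?(eqP kerf) ?capv0 //.
move=> dims; have dWt := dimvS (subvf W); have sWd := dimvS sW.
have h1 := hilbertE s t; have h2 := hilbertE s (t + deg a).
have h3 := hilbertE (a :: s) (t + deg a).
rewrite -/U in h2; unfold reverse_coercion in *.
exists (\dim {: dhomog n.+1 k t} - \dim W)%N; unfold reverse_coercion.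
split; [lia|lia|].
have -> : (\dim {: dhomog n.+1 k t} - \dim W)%N = hilbert s t <->
    \dim W = \dim (ideal_part s t) by unfold reverse_coercion; lia.
split=> [dWs u Hu Hua|H].
  apply/(ideal_partP _ (DHomog Hu)); have /eqP -> : ideal_part s t == W.
    by rewrite eqEdim sW dWs leqnn.
  exact/WP.
suff -> : W = ideal_part s t by [].
apply/vspaceP => v; apply/idP/idP; last exact: (subvP sW).
by move/WP/H => /(_ (dhomog_is_dhomog v)) /ideal_partP.
Qed.

Lemma hilbert_cons_lt s a t : all homogeneous s -> homogeneous a ->
  (t < deg a)%N -> hilbert (a :: s) t = hilbert s t.
Proof.
move=> Hs Ha td; apply: hilbert_congr => u Hu; split; last exact: in_ideal_cons.
exact: (in_ideal_cons_homog_lt Ha Hs Hu td).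
Qed.

Lemma hilbert_nonzerodivisor s a t : all homogeneous s -> is_form a ->
  nonzerodivisor s a ->
  (hilbert (a :: s) (t + deg a) + hilbert s t = hilbert s (t + deg a))%N.
Proof.
move=> Hs Ha nza; have [q [_ qE qP]] := hilbert_cons t Hs Ha.
by rewrite -qE; congr addn; apply/esym/qP => u _; apply: nza.
Qed.

(** The dimension of the quotient by a homogeneous ideal, one degree at a time. *)
Definition colength s r :=
  exists T, (forall t, (T <= t)%N -> hilbert s t = 0%N) /\
            (\sum_(t < T) hilbert s t = r)%N.

Lemma irrelevant_colength s : irrelevant s -> exists r, colength s r.
Proof.
move=> [T HT]; exists (\sum_(t < T) hilbert s t)%N, T; split=> // t Tt.
by apply/hilbert_eq0 => u; apply: HT.
Qed.

Lemma colength_sum s r : colength s r -> exists T, forall T', (T <= T')%N ->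
  (\sum_(t < T') hilbert s t = r)%N.
Proof.
move=> [T [HT <-]]; exists T => T' TT'.
rewrite -(subnKC TT') big_split_ord /= -[RHS]addn0; congr addn.
by rewrite big1 // => i _; rewrite HT // leq_addr.
Qed.

Lemma colength_uniq s r r' : colength s r -> colength s r' -> r = r'.
Proof.
move=> /colength_sum[T HT] /colength_sum[T' HT'].
by rewrite -(HT (T + T')%N) ?HT' ?leq_addl ?leq_addr.
Qed.

Lemma colength_congr s s' r : (forall u, in_ideal s u <-> in_ideal s' u) ->
  colength s r -> colength s' r.
Proof.
move=> ss' [T [HT <-]]; have h t : hilbert s' t = hilbert s t.
  by apply: hilbert_congr => u _; split=> /ss'.
by exists T; split=> [t /HT|]; rewrite ?h //; apply: eq_bigr.
Qed.

(** Telescoping sum of [hilbert_nonzerodivisor]. *)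
Lemma colength_window s a r : all homogeneous s -> is_form a ->
  nonzerodivisor s a -> colength (a :: s) r ->
  exists T, forall t, (T <= t)%N -> (\sum_(i < deg a) hilbert s (t + i) = r)%N.
Proof.
move=> Hs Ha nza /colength_sum[T HT]; exists T => t Tt.
have tele : (\sum_(i < t + deg a) hilbert (a :: s) i + \sum_(i < t) hilbert s i
             = \sum_(i < t + deg a) hilbert s i)%N.
  elim: t {Tt} => [|t IH].
    rewrite big_ord0 addn0; apply: eq_bigr => i _.
    by apply: hilbert_cons_lt => //; apply: is_form_homogeneous.
  rewrite addSn !big_ord_recr /= -IH -(hilbert_nonzerodivisor t Hs Ha nza).
  exact: addnACA.
move: tele; rewrite HT; last by lia.
by rewrite [RHS]big_split_ord /= addnC => /addnI.
Qed.

(** Modulo [s] the Hilbert function is eventually periodic of period [deg a].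
    Multiplication by [b] is onto in high degree, so that the Hilbert function does
    not increase along steps of [deg b]; by periodicity it does not decrease
    either, and multiplication by [b] is injective in high degree. It is then
    injective everywhere, since [a] brings every element into high degree
    injectively. The sum of the Hilbert function over [deg a * deg b] consecutive
    degrees gives the ratio of the colengths. *)
Lemma regular_exchange a b s : is_form a -> is_form b -> all homogeneous s ->
  regular (a :: s) -> irrelevant (a :: s) -> irrelevant (b :: s) ->
  regular (b :: s) /\
  (forall r r', colength (a :: s) r -> colength (b :: s) r' ->
    r * deg b = r' * deg a)%N.
Proof.
move=> Ha Hb Hs [rs nza] /irrelevant_colength[r Hr] Hirr.
have [_ a_gt0] := andP Ha; have [HHb b_gt0] := andP Hb.
have [T HT] := colength_window Hs Ha nza Hr.
have per m t Tt := @window_periodic _ _ _ _ m t HT Tt.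
have nzb : nonzerodivisor s b.
  have [T' HT'] := Hirr.
  have hle t : (T' <= t)%N -> (hilbert s (t + deg b) <= hilbert s t)%N.
    move=> Tt; have [q [q_le qE _]] := hilbert_cons t Hs Hb.
    rewrite -qE (_ : hilbert (b :: s) _ = 0%N) //; apply/hilbert_eq0 => u.
    by apply: HT'; lia.
  have hle_iter m t : (T' <= t)%N -> (hilbert s (t + m * deg b) <= hilbert s t)%N.
    elim: m => [|m IH] Tt; first by rewrite addn0.
    by rewrite mulSnr addnA (leq_trans (hle _ _)) ?IH //; lia.
  (* The period deg a, repeated deg b times, is also deg a steps of length deg b. *)
  have heq t : (T + T' <= t)%N -> hilbert s (t + deg b) = hilbert s t.
    move=> Tt; apply/eqP; rewrite eqn_leq hle; last by lia.
    rewrite -{1}(per (deg b) t); last by lia.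
    have -> : (t + deg b * deg a = t + deg b + (deg a).-1 * deg b)%N.
      by rewrite -addnA -mulSn prednK // mulnC.
    by apply: hle_iter; lia.
  apply: nonzerodivisor_homog => // t u Hu Hub.
  apply: (nonzerodivisor_exp (m := T + T') nza); rewrite mulrC.
  have Hau : a ^+ (T + T') * u \is (deg a * (T + T') + t).-homog.
    apply: dhomogM Hu; apply: dhomogMn; exact: is_form_homogeneous.
  have Tt : (T + T' <= deg a * (T + T') + t)%N.
    by rewrite -[leqLHS]addn0 leq_add // leq_pmull.
  have [q [_ qE qP]] := hilbert_cons (deg a * (T + T') + t) Hs Hb.
  apply: (qP.1 _ _ Hau); last by rewrite -mulrA; apply: in_idealMl.
  rewrite -(heq _ Tt) -qE (_ : hilbert (b :: s) _ = 0%N) //; apply/hilbert_eq0 => v.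
  by apply: HT'; lia.
split=> // r1 r' Hr1 Hr'; rewrite (colength_uniq Hr1 Hr).
have [T' HT'] := colength_window Hs Hb nzb Hr'.
have H1 t : (T + T' <= t)%N -> (\sum_(i < deg a) hilbert s (t + i) = r)%N.
  by move=> Tt; apply: HT; lia.
have H2 t : (T + T' <= t)%N -> (\sum_(i < deg b) hilbert s (t + i) = r')%N.
  by move=> Tt; apply: HT'; lia.
rewrite mulnC -(sum_windows (deg b) H1) mulnC (sum_windows (deg a) H2); exact: mulnC.
Qed.

End HilbertFunction.

(** * Bezout's theorem for forms *)

Section GenericLinearForm.
Context {k : closedFieldType} {n : nat}.
Local Notation A := {mpoly k[n.+1]}.
Implicit Types (s : seq A) (a b c l u v w : A) (t d m r : nat) (y : 'rV[k]_n.+1).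

Lemma homog_evalZ d a (z : k) y : a \is d.-homog ->
  a.@[(z *: y) 0] = z ^+ d * a.@[y 0].
Proof.
move=> /dhomogP Ha; rewrite !mevalE mulr_sumr; apply: eq_big_seq => m /Ha md.
rewrite mulrCA; congr (_ * _); rewrite -(md : mdeg m = d) mdegE -prodrXr -big_split /=.
by apply: eq_bigr => i _; rewrite mxE exprMn.
Qed.

(** The linear form is sought on the curve [\sum_i z ^ i X_i], where each point
    excludes the roots of a nonzero polynomial in [z]. *)
Lemma exists_linear_form (pts : seq 'rV[k]_n.+1) : (forall y, y \in pts -> y != 0) ->
  exists l, [/\ is_form l, deg l = 1%N & forall y, y \in pts -> l.@[y 0] != 0].
Proof.
move=> pts0; have : \prod_(y <- pts) rVpoly y != 0.
  rewrite prodf_seq_neq0; apply/allP => y /pts0 /=; apply: contra => /eqP y0.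
  by rewrite -(rVpolyK y) y0 linear0.
move=> /closed_nonrootP[z]; rewrite /root horner_prod prodf_seq_neq0 => /allP Hz.
pose l : A := \sum_(i < n.+1) z ^+ i *: 'X_i.
have l1 : l \is 1.-homog.
  apply: rpred_sum => i _; apply: dhomogZ; rewrite -(@deg_mpolyX k _ i).
  exact/is_form_homogeneous/is_form_mpolyX.
have l0 : l != 0.
  apply/eqP => /(congr1 (mcoeff U_(ord0))); rewrite mcoeff0 linear_sum big_ord_recl /=.
  rewrite mcoeffZ mcoeffXU eqxx expr0 mulr1 big1 ?addr0; last first.
    by move=> i _; rewrite mcoeffZ mcoeffXU mulr0.
  by move/eqP; rewrite oner_eq0.
have dl := deg_homog l0 l1.
exists l; split => [|//|y yp]; first by rewrite /is_form /homogeneous dl l1.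
have := Hz y yp; congr (_ != 0); rewrite (@horner_coef_wide _ n.+1); last exact: size_poly.
rewrite linear_sum /=; apply: eq_bigr => i _; rewrite mevalZ mevalXU mulrC.
by rewrite coef_rVpoly_ord.
Qed.

(** A common zero of [s] can be scaled so that [b] takes the value [1]; the zeros
    of [s] with this property are finitely many. *)
Lemma irrelevant_finite_directions b s : is_form b -> all homogeneous s ->
  irrelevant (b :: s) -> exists2 pts : seq 'rV[k]_n.+1, forall y, y \in pts -> y != 0 &
    forall y, y != 0 -> vanishes s y -> exists z : k, z *: y \in pts.
Proof.
move=> Hb Hs Hirr; have [HHb b_gt0] := andP Hb.
have [pts Hpts] := cofinite_finite_zeros (irrelevant_cofinite Hb Hs Hirr).
exists [seq y <- pts | y != 0] => [y|y y0 Hy]; first by rewrite mem_filter => /andP[].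
have by0 : b.@[y 0] != 0.
  apply: contra y0 => /eqP by0; apply/eqP/(irrelevant_zero Hirr) => a.
  by rewrite inE => /orP[/eqP ->|/Hy].
have /closed_rootP[z] : size ('X^(deg b) - (b.@[y 0])^-1%:P : {poly k}) != 1%N.
  by rewrite size_XnsubC // eqSS -lt0n.
rewrite /root !hornerE subr_eq0 => /eqP zb; exists z.
have z0 : z != 0.
  apply: contraNneq by0 => z0; rewrite -invr_eq0 -zb z0 expr0n.
  by rewrite eqn0Ngt b_gt0.
rewrite mem_filter scaler_eq0 negb_or z0 y0 /=; apply: Hpts => a.
rewrite inE => /orP[/eqP ->|as_].
  by rewrite mevalB meval1 (homog_evalZ _ _ HHb) zb mulVf ?subrr.
by rewrite (homog_evalZ _ _ (allP Hs _ as_)) Hy // mulr0.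
Qed.

Lemma exists_common_linear_form b1 s1 b2 s2 :
  is_form b1 -> all homogeneous s1 -> irrelevant (b1 :: s1) ->
  is_form b2 -> all homogeneous s2 -> irrelevant (b2 :: s2) ->
  exists l, [/\ is_form l, deg l = 1%N, irrelevant (l :: s1) & irrelevant (l :: s2)].
Proof.
move=> Hb1 Hs1 /(irrelevant_finite_directions Hb1 Hs1)[pts1 pts1_0 H1].
move=> Hb2 Hs2 /(irrelevant_finite_directions Hb2 Hs2)[pts2 pts2_0 H2].
have [|l [Hl dl l0]] := @exists_linear_form (pts1 ++ pts2).
  by move=> y; rewrite mem_cat => /orP[/pts1_0|/pts2_0].
have Hirr s (pts : seq 'rV[k]_n.+1) : all homogeneous s -> {subset pts <= pts1 ++ pts2} ->
    (forall y, y != 0 -> vanishes s y -> exists z : k, z *: y \in pts) ->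
    irrelevant (l :: s).
  move=> Hs sub H; apply: projective_nullstellensatz => /=.
    by rewrite Hs is_form_homogeneous.
  move=> y Hy; apply: contrapT => /eqP y0.
  have [|z /sub /l0] := H y y0; first by move=> a as_; apply: Hy; rewrite inE as_ orbT.
  rewrite (homog_evalZ _ _ (is_form_homogeneous Hl)) (Hy l) ?mulr0 ?eqxx //.
  exact: mem_head.
exists l; split=> //.
  by apply: (Hirr s1 pts1) => // y yp; rewrite mem_cat yp.
by apply: (Hirr _ pts2) => // y yp; rewrite mem_cat yp orbT.
Qed.

(** The forms of [E] are traded for linear forms, and these for the forms of [F],
    one at a time; the linear forms are chosen so that every list met on the way
    generates an irrelevant ideal. *)
Lemma regular_exchange_all m (E F L : seq A) : size E = m -> size F = m ->
  all is_form E -> all is_form F -> all is_form L ->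
  irrelevant (E ++ L) -> irrelevant (F ++ L) -> regular (E ++ L) ->
  regular (F ++ L) /\ (forall r r', colength (E ++ L) r -> colength (F ++ L) r' ->
    r * \prod_(a <- F) deg a = r' * \prod_(a <- E) deg a)%N.
Proof.
elim: m E F L => [|m IH] [|a E] [|b F] //= L.
  by move=> _ _ _ _ _ _ _ rL; split=> // r r' Hr Hr'; rewrite (colength_uniq Hr Hr').
move=> [sE] [sF] /andP[Ha HE] /andP[Hb HF] HL iE iF rE.
have HEL : all homogeneous (E ++ L) by rewrite all_form_homogeneous // all_cat HE.
have HFL : all homogeneous (F ++ L) by rewrite all_form_homogeneous // all_cat HF.
have [l [Hl dl ilE ilF]] := exists_common_linear_form Ha HEL iE Hb HFL iF.
have perml s : (l :: s ++ L) =i s ++ l :: L.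
  by move=> c; rewrite !(inE, mem_cat); exact: orbCA.
have ideall s u : in_ideal (l :: s ++ L) u <-> in_ideal (s ++ l :: L) u.
  by split; apply: in_ideal_sub => c; rewrite perml.
have [rlE rE1] := regular_exchange Ha Hl HEL rE iE ilE.
have [||||rlF rEF] := IH E F (l :: L) sE sF HE HF.
- by rewrite /= Hl.
- by apply: irrelevant_sub ilE => c; rewrite perml.
- by apply: irrelevant_sub ilF => c; rewrite perml.
- by apply: regular_insert rlE; rewrite all_cat HE /= Hl.
have [|rF rF1] := regular_exchange Hl Hb HFL _ ilF iF.
  by apply: regular_front rlF; rewrite all_cat HF /= Hl.
split=> // r r' Hr Hr'.
have [r1 Hr1] := irrelevant_colength ilE; have [r2 Hr2] := irrelevant_colength ilF.
have := rE1 _ _ Hr Hr1; have := rF1 _ _ Hr2 Hr'.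
have := rEF _ _ (colength_congr (ideall _) Hr1) (colength_congr (ideall _) Hr2).
rewrite dl !muln1 !big_cons => e2 <- ->.
set PE := (\prod_(c <- E) deg c)%N in e2 *; set PF := (\prod_(c <- F) deg c)%N in e2 *.
have -> : (r1 * deg a * (deg b * PF) = deg a * deg b * (r1 * PF))%N by ring.
by rewrite e2; ring.
Qed.

Lemma in_ideal_variablesP (r : seq 'I_n.+1) u :
  in_ideal [seq 'X_i : A | i <- r] u <->
  (forall m : 'X_{1..n.+1}, m \in msupp u -> exists2 i, i \in r & (0 < m i)%N).
Proof.
split; last exact: in_ideal_variables.
elim: r u => [u -> m|i r IH u [c /IH Hc] m]; first by rewrite msupp0.
rewrite mcoeff_msupp -(subrK (c * 'X_i) u) mcoeffD => um.
have [c0|/eqP] := eqVneq (c * 'X_i)@_m 0.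
  move: um; rewrite c0 addr0 -mcoeff_msupp => /Hc[j jr mj].
  by exists j; rewrite // inE jr orbT.
move/eqP; rewrite -mcoeff_msupp (perm_mem (msuppMX _ _)) => /mapP[m' _ ->].
by exists i; rewrite ?mem_head // mnmDE mnm1E eqxx.
Qed.

Lemma regular_variables (r : seq 'I_n.+1) : uniq r -> regular [seq 'X_i : A | i <- r].
Proof.
elim: r => //= i r IH /andP[ir /IH rr]; split=> // u /in_ideal_variablesP Hu.
apply/in_ideal_variablesP => m mu.
have [|j jr mj] := Hu (U_(i) + m)%MM.
  by rewrite (perm_mem (msuppMX _ _)) map_f.
exists j => //; move: mj; rewrite mnmDE mnm1E; case: eqP => // ij.
by rewrite ij jr in ir.
Qed.

Lemma colength_variables : colength [seq 'X_i : A | i <- enum 'I_n.+1] 1.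
Proof.
exists 1%N; split=> [t t_gt0|].
  by apply/hilbert_eq0 => u; apply: in_ideal_all_variables.
rewrite big_ord1.
have dim1 : \dim {: dhomog n.+1 k 0} = 1%N.
  have H1 : (1 : A) \is 0.-homog by apply: dhomog1.
  suff -> : fullv = <[DHomog H1]>%VS by rewrite dim_vline -val_eqE /= oner_eq0.
  apply/vspaceP => x; rewrite memvf; apply/esym/vlineP; exists (val x)@_0.
  apply/val_inj; rewrite /= -mul_mpolyC mulr1; apply: msize1_polyC.
  exact/msize_homog/dhomog_is_dhomog.
have := hilbertE [seq 'X_i : A | i <- enum 'I_n.+1] 0; rewrite dim1.
suff /eqP -> : \dim (ideal_part [seq 'X_i : A | i <- enum 'I_n.+1] 0) == 0%N by rewrite addn0.
rewrite dimv_eq0 -subv0; apply/subvP => x /ideal_partP.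
move/in_ideal_variablesP => Hx; rewrite memv0; apply/eqP/val_inj/eqP.
rewrite -msupp_eq0 /=; case E : (msupp _) => [//|m r].
have := Hx m; rewrite E mem_head => /(_ isT)[i _].
have /dhomogP/(_ m) := dhomog_is_dhomog x; rewrite E mem_head => /(_ isT) md0.
have /eqP := md0 : mdeg m = 0%N; rewrite mdeg_eq0 => /eqP ->; by rewrite mnm0E.
Qed.

(** Bezout's theorem for forms, together with the Cohen-Macaulay property: the
    variables are exchanged for the forms of [s]. *)
Theorem bezout_forms s : size s = n.+1 -> all is_form s -> irrelevant s ->
  regular s /\ colength s (\prod_(a <- s) deg a)%N.
Proof.
move=> ss Hs Hirr; pose V := [seq 'X_i : A | i <- enum 'I_n.+1].
have sV : size V = n.+1 by rewrite size_map size_enum_ord.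
have HV : all is_form V by apply/allP => _ /mapP[i _ ->]; apply: is_form_mpolyX.
have := @regular_exchange_all n.+1 V s [::] sV ss HV Hs isT; rewrite !cats0.
move=> /(_ irrelevant_variables Hirr (regular_variables (enum_uniq _)))[rs Hr].
split=> //; have [r' Hr'] := irrelevant_colength Hirr.
have := Hr _ _ colength_variables Hr'; rewrite mul1n => ->.
rewrite big_map big1 ?muln1 // => i _; exact: deg_mpolyX.
Qed.

End GenericLinearForm.

(** * From top components to polynomials *)

Section TopComponents.
Context {k : fieldType} {n : nat}.
Local Notation A := {mpoly k[n]}.
Implicit Types (s : seq A) (a b c u v w : A) (t d e : nat).

Lemma msizeB_le t u v : (msize u <= t)%N -> (msize v <= t)%N -> (msize (u - v) <= t)%N.
Proof. by move=> ut vt; rewrite (leq_trans (msizeD_le _ _)) // geq_max ut msizeN. Qed.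

Lemma msizeM_leq e d c a : (msize c <= e)%N -> (msize a <= d.+1)%N ->
  (msize (c * a) <= e + d)%N.
Proof.
have [-> _ _|c0] := eqVneq c 0; first by rewrite mul0r mmeasure0.
have [-> _ _|a0] := eqVneq a 0; first by rewrite mulr0 mmeasure0.
move=> ce ad; rewrite msizeM // (leq_trans (_ : _ <= (e + d.+1).-1)%N) ?addnS //.
by rewrite -addnS -!subn1 leq_sub2r // leq_add.
Qed.

Lemma component_top_mul e d c a : (msize c <= e.+1)%N -> (msize a <= d.+1)%N ->
  component (e + d) (c * a) = component e c * component d a.
Proof.
move=> ce ad; rewrite -{1}(subrK (component d a) a) mulrDr linearD /=.
rewrite (componentMr _ _ (pihomogP _ _ _)) [X in X + _]component_ge ?add0r //.
rewrite mulrC addnC; apply: msizeM_leq => //; apply: msize_le_component.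
  by apply: msizeB_le => //; apply/msize_homog/pihomogP.
by rewrite linearB /= (component_homog (pihomogP _ _ _)) subrr.
Qed.

Lemma top_component_neq0 a : a != 0 -> top_component a != 0.
Proof.
move=> a0; apply/eqP => top0.
have aS : (msize a <= (deg a).+1)%N by rewrite /deg -mpolySpred.
by have := msize_le_component aS top0; rewrite {1}(mpolySpred mdeg a0) ltnn.
Qed.

Lemma deg_top_component a : a != 0 -> deg (top_component a) = deg a.
Proof. by move=> a0; apply: deg_homog (top_component_neq0 a0) (pihomogP _ _ _). Qed.

Lemma is_form_top_component a : (0 < deg a)%N -> is_form (top_component a).
Proof.
move=> d0; have a0 : a != 0 by apply: contraTneq d0 => ->; rewrite /deg mmeasure0.
by rewrite /is_form /homogeneous deg_top_component // d0 pihomogP.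
Qed.

Local Notation tops s := [seq top_component a | a <- s].

Lemma all_is_form_tops s : all (fun a => 0 < deg a)%N s -> all is_form (tops s).
Proof. by rewrite all_map; apply: sub_all => a; apply: is_form_top_component. Qed.

Lemma lift_top_component s t w : all (fun a => 0 < deg a)%N s ->
  w \is t.-homog -> in_ideal (tops s) w ->
  exists v, [/\ in_ideal s v, (msize v <= t.+1)%N & component t v = w].
Proof.
elim: s w => [w _ _ ->|a s IH w /= /andP[Ha Hs] Hw Hiw].
  by exists 0; split; rewrite ?raddf0 ?mmeasure0.
have a0 : a != 0 by apply: contraTneq Ha => ->; rewrite /deg mmeasure0.
have Hfs := all_form_homogeneous (all_is_form_tops Hs).
have Hfa := is_form_homogeneous (is_form_top_component Ha).
have [td|dt] := ltnP t (deg a).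
  rewrite -(deg_top_component a0) in td.
  have [v [Hv vt vw]] := IH _ Hs Hw (in_ideal_cons_homog_lt Hfa Hfs Hw td Hiw).
  by exists v; split=> //; apply: in_ideal_cons.
rewrite -(subnK dt) -{2}(deg_top_component a0) in Hw.
have [c Hc Hwc] := in_ideal_cons_homog Hfa Hfs Hw Hiw.
rewrite deg_top_component // subnK // in Hw.
have Hca : c * top_component a \is t.-homog.
  by rewrite -(subnK dt); apply: dhomogM Hc (pihomogP _ _ _).
have [v [Hv vt vw]] := IH _ Hs (rpredB Hw Hca) Hwc.
have aS : (msize a <= (deg a).+1)%N by rewrite /deg -mpolySpred.
exists (v + c * a); split.
- by apply: (@in_ideal_consP _ _ _ _ c); rewrite addrK.
- rewrite (leq_trans (msizeD_le _ _)) // geq_max vt /=.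
  by have := msizeM_leq (msize_homog Hc) aS; rewrite addSn subnK.
- rewrite linearD /= vw -(subnK dt) (component_top_mul (msize_homog Hc) aS).
  by rewrite (component_homog Hc) subrK.
Qed.

(** For a regular sequence of top components, the top components of the ideal lie
    in the ideal of the top components. In [u = c * a + ..], when the degree of
    [c * a] exceeds that of [u], its top component cancels against the other
    terms; by regularity the top component of [c] comes from the other
    generators and can be removed. *)
Lemma in_ideal_top_component s t u : all (fun a => 0 < deg a)%N s ->
  regular (tops s) -> in_ideal s u -> (msize u <= t.+1)%N ->
  in_ideal (tops s) (component t u).
Proof.
elim: s t u => [|a s IH] t u /=; first by move=> _ _ -> _; rewrite raddf0.
move=> /andP[Ha Hs] [rs nza] [c Hc] ut.
have aS : (msize a <= (deg a).+1)%N.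
  by rewrite /deg -mpolySpred //; apply: contraTneq Ha => ->; rewrite /deg mmeasure0.
have [N] := ubnP (msize c); elim: N c Hc => // N IHN c Hc cN.
have [c_small|c_big] := leqP (msize c + deg a) t.+1.
  have ca_small : (msize (c * a) <= t.+1)%N.
    by apply: leq_trans c_small; apply: msizeM_leq.
  exists (component (t - deg a) c).
  have -> : component (t - deg a) c * top_component a = component t (c * a).
    have [td|dt] := ltnP t (deg a).
      have -> : c = 0 by apply/eqP; rewrite -msize_poly_eq0; lia.
      by rewrite mul0r !raddf0 mul0r.
    rewrite -{2}(subnK dt) component_top_mul //.
    by rewrite -(leq_add2r (deg a)) addSn subnK.
  by rewrite -linearB; apply: IH => //; apply: msizeB_le.
have [c0|c0] := eqVneq c 0.
  by apply: in_ideal_cons; apply: IH => //; move: Hc; rewrite c0 mul0r subr0.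
have cS := mpolySpred mdeg c0; set e := (msize c).-1 in cS.
have Hec : in_ideal (tops s) (component e c).
  have cS' : (msize c <= e.+1)%N by rewrite -cS.
  apply: nza; rewrite -(component_top_mul cS' aS).
  have -> : component (e + deg a) (c * a) = - component (e + deg a) (u - c * a).
    rewrite linearB /= (@component_ge _ _ (e + deg a) u) ?sub0r ?opprK //.
    by apply: leq_trans ut _; lia.
  apply: in_idealN; apply: IH => //; apply: msizeB_le.
    by apply: leq_trans ut _; lia.
  by rewrite -addSn; apply: msizeM_leq.
have [w [Hw we wE]] := lift_top_component Hs (pihomogP _ _ _) Hec.
apply: (IHN (c - w)).
  have -> : u - (c - w) * a = u - c * a + a * w by ring.
  by apply: in_idealD => //; apply: in_idealMl.
have : (msize (c - w) <= e)%N.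
  apply: msize_le_component; first by rewrite msizeB_le // -cS.
  by rewrite linearB /= wE subrr.
by lia.
Qed.

End TopComponents.

Definition quotient_basis (k : fieldType) (n : nat) (s : seq {mpoly k[n]}) (N : nat)
    (b : 'I_N -> {mpoly k[n]}) :=
  (forall c : 'rV[k]_N, in_ideal s (\sum_i c 0 i *: b i) -> c = 0) /\
  (forall u, exists c : 'rV[k]_N, in_ideal s (u - \sum_i c 0 i *: b i)).

Section QuotientBasis.
Context {k : fieldType} {n : nat}.
Local Notation A := {mpoly k[n.+1]}.
Local Notation tops s := [seq top_component a | a <- s].
Implicit Types (s : seq A) (a u v w : A) (t T N r : nat).

(** In each degree, complements of the ideal of top components in the space of forms
    provide the basis elements; [lift_top_component] corrects a congruence between
    top components to a congruence modulo [s] up to lower degree. *)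
Lemma truncated_quotient_basis s T : all (fun a => 0 < deg a)%N s -> regular (tops s) ->
  exists N (b : 'I_N -> A), [/\ N = (\sum_(t < T) hilbert (tops s) t)%N,
    forall i, (msize (b i) <= T)%N,
    forall c : 'rV[k]_N, in_ideal s (\sum_i c 0 i *: b i) -> c = 0 &
    forall u, (msize u <= T)%N ->
      exists c : 'rV[k]_N, in_ideal s (u - \sum_i c 0 i *: b i)].
Proof.
move=> Hs rs; elim: T => [|T [N [b [NE bT bfree bspan]]]].
  exists 0%N, (fun=> 0); split=> [|[]//|c _|u]; first by rewrite big_ord0.
    by apply/rowP => -[].
  rewrite leqn0 msize_poly_eq0 => /eqP ->; exists 0.
  by rewrite big_ord0 subrr; apply: in_ideal0.
pose C := (ideal_part (tops s) T)^C%VS; pose h := hilbert (tops s) T.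
pose e (j : 'I_h) : A := val ((vbasis C)`_j).
have eh j : e j \is T.-homog by apply: dhomog_is_dhomog.
pose b' (i : 'I_(N + h)) : A := match split i with inl j => b j | inr j => e j end.
have bl j : b' (lshift h j) = b j by rewrite /b' (unsplitK (inl _ j)).
have br j : b' (rshift N j) = e j by rewrite /b' (unsplitK (inr _ j)).
have sumb' (c : 'rV[k]_(N + h)) : \sum_i c 0 i *: b' i =
    \sum_i lsubmx c 0 i *: b i + \sum_j rsubmx c 0 j *: e j.
  rewrite big_split_ord /=; congr (_ + _); apply: eq_bigr => i _.
    by rewrite bl mxE.
  by rewrite br mxE.
have sum_small (c : 'rV[k]_N) : (msize (\sum_i c 0 i *: b i) <= T)%N.
  rewrite (leq_trans (msize_sum _ _ _)) //; apply/bigmax_leqP => i _.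
  exact: leq_trans (msizeZ_le _ _) (bT i).
have sum_homog (c : 'rV[k]_h) : \sum_j c 0 j *: e j \is T.-homog.
  by apply: rpred_sum => j _; apply: dhomogZ.
have sum_val (c : 'rV[k]_h) :
    \sum_j c 0 j *: e j = val (\sum_j c 0 j *: (vbasis C)`_j).
  by rewrite linear_sum; apply: eq_bigr => j _; rewrite linearZ.
exists (N + h)%N, b'; split.
- by rewrite big_ord_recr /= -NE.
- move=> i; rewrite /b'; case: (split i) => j; first exact: leqW.
  exact: msize_homog.
- move=> c; rewrite sumb' => Hc.
  have r0 : rsubmx c = 0.
    apply/rowP => j; rewrite [RHS]mxE.
    suff : \sum_j rsubmx c 0 j *: (vbasis C)`_j = 0.
      by move/freeP: (basis_free (vbasisP C)) => /[apply].
    apply/eqP; rewrite -memv0 -(capv_compl (ideal_part (tops s) T)) memv_cap.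
    apply/andP; split.
      apply/ideal_partP; rewrite -sum_val -(component_homog (sum_homog _)).
      rewrite -[X in component _ X](addKr (\sum_i lsubmx c 0 i *: b i)).
      rewrite addrC linearB /= (component_ge (sum_small _)) subr0.
      apply: in_ideal_top_component => //.
      rewrite (leq_trans (msizeD_le _ _)) // geq_max leqW //=.
      exact/msize_homog/sum_homog.
    apply: rpred_sum => j' _; apply/rpredZ/vbasis_mem/mem_nth.
    by rewrite size_tuple.
  move: Hc; rewrite r0 [X in _ + X]big1 ?addr0; last by move=> j _; rewrite mxE scale0r.
  by move/bfree => l0; rewrite -[c]hsubmxK l0 r0 row_mx0.
- move=> u uT; pose x := DHomog (pihomogP mdeg T u).
  have : x \in (ideal_part (tops s) T + C)%VS by rewrite addv_complf memvf.
  case/memv_addP => p /ideal_partP Hp [q qC xpq].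
  have [w [Hw wT wp]] := lift_top_component Hs (dhomog_is_dhomog p) Hp.
  pose cr : 'rV[k]_h := \row_j coord (vbasis C) j q.
  have qE : val q = \sum_j cr 0 j *: e j.
    rewrite sum_val {1}(coord_vbasis qC); congr (val _).
    by apply: eq_bigr => j _; rewrite mxE.
  have [|cl Hcl] := bspan (u - val q - w).
    apply: msize_le_component.
      by rewrite !msizeB_le // msize_homog // dhomog_is_dhomog.
    rewrite !linearB /= wp (component_homog (dhomog_is_dhomog q)).
    have -> : component T u = val p + val q by rewrite -[LHS]/(val x) xpq.
    by rewrite addrK subrr.
  exists (row_mx cl cr); rewrite sumb' row_mxKl row_mxKr -qE.
  have -> : u - (\sum_i cl 0 i *: b i + val q) = u - val q - w - \sum_i cl 0 i *: b i + w.
    by ring.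
  exact: in_idealD.
Qed.

(** In degrees where the Hilbert function of the top components vanishes, every top
    component can be removed modulo [s], so a truncated basis already spans. *)
Theorem bezout_quotient_basis s r : all (fun a => 0 < deg a)%N s ->
  regular (tops s) -> colength (tops s) r ->
  exists b : 'I_r -> A, quotient_basis s b.
Proof.
move=> Hs rs Hr; have [T [HT rE]] := Hr.
have [N [b [NE bT bfree bspan]]] := truncated_quotient_basis T Hs rs.
rewrite rE in NE; move: b bT bfree bspan; rewrite NE => b bT bfree bspan.
exists b; split=> // u; have [j uj] : exists j, (msize u <= T + j)%N.
  by exists (msize u); apply: leq_addl.
elim: j u uj => [|j IH] u uj; first by apply: bspan; rewrite addn0 in uj.
have top_u : in_ideal (tops s) (component (T + j) u).
  apply/((hilbert_eq0 _ _).1 (HT _ (leq_addr _ _)))/pihomogP.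
have [w [Hw wT wu]] := lift_top_component Hs (pihomogP _ _ _) top_u.
rewrite addnS in uj.
have [|c Hc] := IH (u - w).
  apply: msize_le_component; first exact: msizeB_le.
  by rewrite linearB /= wu subrr.
exists c; rewrite -(subrK w u) addrAC; exact: in_idealD.
Qed.

End QuotientBasis.

(** * Joint generalized eigenspaces of commuting matrices *)

Section JointGeneralizedEigenspaces.
Context {k : closedFieldType} {N : nat}.
Implicit Types (U Y Z : 'M[k]_N.+1) (a z : k) (p q : {poly k}).

Lemma in_kermxpoly Y p (v : 'rV[k]_N.+1) :
  (v <= kermxpoly Y p)%MS = (v *m horner_mx Y p == 0).
Proof. by apply/sub_kermxP/eqP. Qed.

Lemma kermxpoly_dvd Y p q : p %| q -> (kermxpoly Y p <= kermxpoly Y q)%MS.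
Proof.
move=> /dvdpP[w ->]; apply/rV_subP => v; rewrite !in_kermxpoly => /eqP vp.
by rewrite mulrC rmorphM /= mulmxA vp mul0mx.
Qed.

Lemma sub_kermxpoly_char_poly U Y : (U <= kermxpoly Y (char_poly Y))%MS.
Proof. by apply/rV_subP => v _; rewrite in_kermxpoly Cayley_Hamilton mulmx0. Qed.

(** A gcd with the characteristic polynomial bounds the exponent by the dimension. *)
Lemma in_geigenspace Y a (v : 'rV[k]_N.+1) m :
  v *m horner_mx Y (('X - a%:P) ^+ m) = 0 -> (v <= geigenspace Y a)%MS.
Proof.
move=> vm; set P := ('X - a%:P) ^+ m in vm.
have /dvdp_exp_XsubCP[j _ gj] := dvdp_gcdl P (char_poly Y).
have jN : (j <= N.+1)%N.
  have := dvdp_leq (monic_neq0 (char_poly_monic Y)) (dvdp_gcdr P (char_poly Y)).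
  by rewrite size_char_poly (eqp_size gj) size_exp_XsubC ltnS.
suff vj : (v <= kermxpoly Y (gcdp P (char_poly Y)))%MS.
  apply: submx_trans vj _; apply: kermxpoly_dvd.
  by rewrite (eqp_dvdl _ gj) dvdp_exp2l.
have [[u w] /= Huw] := Bezoutp P (char_poly Y).
have /andP[/dvdpP[e ->] _] := Huw.
have -> : e * (u * P + w * char_poly Y) = P * (u * e) + char_poly Y * (w * e) by ring.
rewrite in_kermxpoly rmorphD !rmorphM /= Cayley_Hamilton mul0r addr0.
by rewrite -!mulmxE !mulmxA vm !mul0mx.
Qed.

Lemma geigenspace_neq0 Y a : geigenspace Y a != 0 -> root (char_poly Y) a.
Proof.
apply: contraR => ra; apply/eqP.
have cop : coprimep (('X - a%:P) ^+ N.+1) (char_poly Y).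
  by rewrite coprimep_expl // coprimep_sym coprimep_XsubC.
have := mxdirect_kermxpoly Y cop.
by move=> cap0; apply/eqP; rewrite -submx0 -cap0 sub_capmx submx_refl sub_kermxpoly_char_poly.
Qed.

Lemma cap_kermxpolyM U Y p q : stablemx U Y -> coprimep p q ->
  \rank (U :&: kermxpoly Y (p * q))%MS =
  (\rank (U :&: kermxpoly Y p)%MS + \rank (U :&: kermxpoly Y q)%MS)%N.
Proof.
move=> UY cpq; rewrite -mxrank_disjoint_sum; last first.
  apply/eqP; rewrite -submx0 -(mxdirect_kermxpoly Y cpq) sub_capmx.
  by rewrite (submx_trans (capmxSl _ _)) ?capmxSr //= (submx_trans (capmxSr _ _)) ?capmxSr.
apply: eqmx_rank; apply/andP; split; last first.
  rewrite addsmx_sub !sub_capmx !capmxSl /= !(submx_trans (capmxSr _ _)) //.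
    by apply: kermxpoly_dvd; apply: dvdp_mull.
  by apply: kermxpoly_dvd; apply: dvdp_mulr.
have [[u w] /= uw1] := Bezout_eq1_coprimepP _ _ cpq.
apply/rV_subP => v; rewrite sub_capmx in_kermxpoly => /andP[vU /eqP vpq].
have stab (r : {poly k}) : (v *m horner_mx Y r <= U)%MS.
  by apply: submx_trans (horner_mx_stable r UY); apply: submxMr.
have -> : v = v *m horner_mx Y (w * q) + v *m horner_mx Y (u * p).
  by rewrite -mulmxDr -rmorphD addrC uw1 rmorph1 mulmx1.
have v0 e : v *m horner_mx Y (p * q * e) = 0.
  by rewrite rmorphM /= -mulmxE mulmxA vpq mul0mx.
apply: addmx_sub_adds; rewrite sub_capmx stab in_kermxpoly -mulmxA mulmxE -rmorphM /=.
  by rewrite (_ : w * q * p = p * q * w) ?v0 //; ring.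
by rewrite (_ : u * p * q = p * q * u) ?v0 //; ring.
Qed.

Lemma rank_cap_geigenspace U Y (E : seq k) : stablemx U Y -> uniq E ->
  (forall a, root (char_poly Y) a -> a \in E) ->
  (\sum_(a <- E) \rank (U :&: geigenspace Y a)%MS = \rank U)%N.
Proof.
move=> UY uE HE; pose P (E' : seq k) := \prod_(a <- E') ('X - a%:P) ^+ N.+1.
have -> : \rank U = \rank (U :&: kermxpoly Y (P E))%MS.
  suff charP : char_poly Y %| P E.
    apply: eqmx_rank; rewrite capmxSl sub_capmx submx_refl /= andbT.
    exact: submx_trans (sub_kermxpoly_char_poly U Y) (kermxpoly_dvd Y charP).
  have [r rE] := closed_field_poly_normal (char_poly Y).
  move: rE; rewrite (monicP (char_poly_monic Y)) scale1r => rE.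
  have sr : size r = N.+1.
    by have := size_char_poly Y; rewrite rE size_prod_XsubC => -[].
  have rPE : {subset r <= E}.
    by move=> a ar; apply: HE; rewrite rE root_prod_XsubC.
  rewrite rE {rE} /P prodrXl -sr; elim: r {sr} rPE => [|a r IH] rE.
    by rewrite big_nil dvd1p.
  rewrite big_cons exprS dvdp_mul //.
    rewrite (big_rem a) ?dvdp_mulIl //=; apply: rE; exact: mem_head.
  by apply: IH => b br; apply: rE; rewrite inE br orbT.
elim: E uE {HE} => [_|a E IH /= /andP[aE uE]].
  by rewrite /P !big_nil kermxpoly1 capmx0 mxrank0.
have cop : coprimep (('X - a%:P) ^+ N.+1) (P E).
  rewrite coprimep_expl // coprimep_sym coprimep_XsubC /root horner_prod.
  rewrite prodf_seq_neq0; apply/allP => b bE /=.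
  rewrite horner_exp hornerXsubC expf_neq0 // subr_eq0.
  by apply: contraNneq aE => ->.
rewrite big_cons (IH uE) [P (a :: E)]big_cons (cap_kermxpolyM UY cop).
reflexivity.
Qed.

Variables (n : nat) (Y : 'I_n -> 'M[k]_N.+1).
Hypothesis Y_comm : forall i j, Y i *m Y j = Y j *m Y i.

Definition partial_joint (r : seq 'I_n) (x : 'rV[k]_n) : 'M[k]_N.+1 :=
  (\bigcap_(i <- r) geigenspace (Y i) (x 0 i))%MS.

Definition joint_geigenspace (x : 'rV[k]_n) : 'M[k]_N.+1 := partial_joint (enum 'I_n) x.

Lemma joint_geigenspaceP (x : 'rV[k]_n) (v : 'rV[k]_N.+1) :
  (v <= joint_geigenspace x)%MS <-> forall i, (v <= geigenspace (Y i) (x 0 i))%MS.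
Proof.
rewrite /joint_geigenspace /partial_joint; split=> [Hv i|Hv].
  apply: (submx_trans Hv); elim: (enum _) (mem_enum 'I_n i) => // j r IH.
  rewrite inE big_cons => /orP[/eqP <-|/IH]; first exact: capmxSl.
  exact/submx_trans/capmxSr.
by elim: (enum _) => [|j r IH]; rewrite ?big_nil ?submx1 // big_cons sub_capmx Hv.
Qed.

Lemma stable_partial_joint r x j : stablemx (partial_joint r x) (Y j).
Proof.
rewrite /partial_joint; elim: r => [|i r IH].
  by rewrite big_nil mul1mx submx1.
rewrite big_cons; rewrite sub_capmx; apply/andP; split.
  apply: submx_trans (submxMr _ (capmxSl _ _)) _.
  by apply: comm_mx_stable_geigenspace; apply: Y_comm.
exact: submx_trans (submxMr _ (capmxSr _ _)) IH.
Qed.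

(** The generalized eigenspaces of one operator split every subspace that the
    operator preserves, so one coordinate of the joint eigenvalue can be summed out
    at a time. *)
Lemma sum_rank_joint_geigenspace : exists pts : seq 'rV[k]_n,
  [/\ uniq pts, forall x, joint_geigenspace x != 0 -> x \in pts &
      (\sum_(x <- pts) \rank (joint_geigenspace x) = N.+1)%N].
Proof.
have [E uE HE] : exists2 E : seq k, uniq E &
    forall i a, root (char_poly (Y i)) a -> a \in E.
  have /choice[R HR] i : exists R : seq k, forall a, root (char_poly (Y i)) a -> a \in R.
    have [r rE] := closed_field_poly_normal (char_poly (Y i)).
    exists r => a; rewrite rE (monicP (char_poly_monic _)) scale1r.
    by rewrite root_prod_XsubC.
  exists (undup (flatten [seq R i | i <- enum 'I_n])); first exact: undup_uniq.
  by move=> i a /HR Ra; rewrite mem_undup; apply/flatten_mapP; exists i; rewrite ?mem_enum.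
suff H r : uniq r -> exists pts : seq 'rV[k]_n,
  [/\ uniq pts, forall x : 'rV[k]_n, x \in pts -> forall i, i \notin r -> x 0 i = 0,
   forall x : 'rV[k]_n, (forall i, i \in r -> x 0 i \in E) -> (forall i, i \notin r -> x 0 i = 0) ->
     x \in pts &
   (\sum_(x <- pts) \rank (partial_joint r x) = N.+1)%N].
  have [pts [upts _ Hpts sum]] := H _ (enum_uniq 'I_n); exists pts; split=> // x x0.
  apply: Hpts => i; last by rewrite mem_enum.
  move=> _; apply: (HE i); apply: geigenspace_neq0.
  apply: contraNneq x0 => g0; rewrite -submx0; apply/rV_subP => v.
  by move/joint_geigenspaceP => /(_ i); rewrite g0.
elim: r => [_|i r IH /= /andP[ir ur]].
  exists [:: 0]; split=> //.
  - by move=> x; rewrite inE => /eqP -> i _; rewrite mxE.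
  - by move=> x _ x0; rewrite inE; apply/eqP/rowP => i; rewrite x0 // mxE.
  - by rewrite big_seq1 /partial_joint big_nil mxrank1.
have [pts [upts pts0 Hpts sum]] := IH ur.
(* The points of [pts] have i-th coordinate 0, to which the eigenvalue is added. *)
pose upd (x : 'rV[k]_n) a := x + a *: delta_mx 0 i.
have updi x a : x \in pts -> upd x a 0 i = a.
  by move=> /pts0 /(_ i ir) xi; rewrite !mxE xi !eqxx mulr1 add0r.
have updj x a j : j != i -> upd x a 0 j = x 0 j.
  by move=> ji; rewrite !mxE (negPf ji) andbF mulr0 addr0.
exists [seq upd x a | x <- pts, a <- E]; split.
- apply: allpairs_uniq => // -[x a] [y b] /allpairsP[[x' a'] /= [xp _ [-> ->]]].
  move=> /allpairsP[[y' b'] /= [yp _ [-> ->]]] e.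
  have ab : a' = b' by rewrite -(updi x' a') // e updi.
  by move: e; rewrite ab => /addIr ->.
- move=> _ /allpairsP[[x a] /= [xp _ ->]] j; rewrite inE negb_or => /andP[ji jr].
  by rewrite updj // pts0.
- move=> x xE x0; apply/allpairsP; exists (upd x (- x 0 i), x 0 i); split=> /=.
  + apply: Hpts => j jr.
      by rewrite updj ?xE ?inE ?jr ?orbT //; apply: contraNneq ir => <-.
    have [->|ji] := eqVneq j i; first by rewrite !mxE !eqxx mulr1 subrr.
    by rewrite updj // x0 // inE negb_or ji.
  + by apply: xE; exact: mem_head.
  + by rewrite /upd scaleNr addrNK.
- rewrite big_allpairs_dep -[RHS]sum big_seq [RHS]big_seq; apply: eq_bigr => x xp.
  rewrite -(rank_cap_geigenspace (stable_partial_joint r x i) uE (HE i)).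
  apply: eq_bigr => a _; rewrite /partial_joint big_cons updi //.
  have -> : (\bigcap_(j <- r) geigenspace (Y j) (upd x a 0 j))%MS =
            (\bigcap_(j <- r) geigenspace (Y j) (x 0 j))%MS.
    rewrite big_seq [RHS]big_seq; apply: eq_bigr => j jr; rewrite updj //.
    by apply: contraNneq ir => <-.
  by rewrite capmxC.
Qed.

End JointGeneralizedEigenspaces.

(** * Differential operators with constant coefficients *)

Section ConstantCoefficientOperators.
Context {k : fieldType} {n : nat}.
Local Notation A := {mpoly k[n]}.
Implicit Types (p q f h : A) (x : 'rV[k]_n) (m : 'X_{1..n}).

Lemma mpoly_mulX_ind (P : A -> Prop) :
  (forall c u v, P u -> P v -> P (c *: u + v)) -> P 1 ->
  (forall i u, P u -> P ('X_i * u)) -> forall u, P u.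
Proof.
move=> PD P1 PX u.
have P0 : P 0 by have := PD (-1) _ _ P1 P1; rewrite scaleN1r addNr.
have PXm m : P 'X_[m].
  rewrite mpolyXE_id; elim/big_rec: _ => // i v _ Pv.
  by elim: (m i) => [|j IH]; rewrite ?expr0 ?mul1r // exprS -mulrA; apply: (PX).
rewrite [u]mpolyE; elim/big_rec: _ => // m v _ Pv; exact: PD.
Qed.

Lemma diffopwE p f K : (msize p <= K)%N ->
  diffop p f = \sum_(m : 'X_{1..n < K}) p@_m *: f^`M[m].
Proof.
move=> pK; rewrite /diffop (ssrcomplements.big_mksub 'X_{1..n < K}) //=; first last.
- by move=> m /msize_mdeg_lt /leq_trans; apply.
- exact: msupp_uniq.
by rewrite big_rmcond //= => m /memN_msupp_eq0 ->; rewrite scale0r.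
Qed.

Lemma diffop_linear f : linear (diffop (k := k) (n := n) ^~ f).
Proof.
move=> c p q; pose K := maxn (msize (c *: p + q)) (maxn (msize p) (msize q)).
rewrite (@diffopwE _ _ K) ?leq_maxl // (@diffopwE p _ K) ?(@diffopwE q _ K); last first.
- by rewrite /K !leq_max leqnn !orbT.
- by rewrite /K !leq_max leqnn !orbT.
rewrite scaler_sumr -big_split /=; apply: eq_bigr => m _.
by rewrite mcoeffD mcoeffZ scalerDl scalerA.
Qed.

Lemma diffopX m f : diffop 'X_[m] f = f^`M[m].
Proof. by rewrite /diffop msuppX big_seq1 mcoeffX eqxx scale1r. Qed.

Lemma mderivm_mulX i f m :
  ('X_i * f)^`M[m] = 'X_i * f^`M[m] + (m i)%:R *: f^`M[m - U_(i)].
Proof.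
have [K] := ubnP (mdeg m); elim: K m => // K IH m mK.
have [->|m0] := eqVneq m 0%MM.
  by rewrite !mderivm0m mnm0E scale0r addr0.
have [j mj] : exists j, (0 < m j)%N by apply: mdeg_gt0; rewrite lt0n mdeg_eq0.
have [m' mE] : exists m', m = (m' + U_(j))%MM.
  by exists (m - U_(j))%MM; rewrite submK // lep1mP -lt0n.
have m'K : (mdeg m' < K)%N by move: mK; rewrite mE mdegD mdeg1; lia.
have fm' : (f^`M[m'])^`M(j) = f^`M[m] by rewrite [in RHS]mE mderivmDm mderivmU1m.
rewrite {1}mE mderivmDm mderivmU1m IH // mderivD mderivM mderivZ fm'.
have -> : ('X_i : A)^`M(j) = (i == j)%:R.
  rewrite mderivX mnm1E; case: eqP => [->|_]; last by rewrite scale0r.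
  by rewrite scale1r -[X in (X - _)%MM]add0m addmK mpolyX0.
rewrite -addrA addrCA; congr (_ + _).
have mi : m i = (m' i + (i == j))%N by rewrite {1}mE mnmDE mnm1E eq_sym.
have [m'i0|m'i_gt0] := posnP (m' i).
  rewrite mi m'i0 add0n scale0r addr0; case: eqP => [ij|_]; last by rewrite mul0r scale0r.
  by rewrite mul1r scale1r ij mE addmK.
have -> : (f^`M[m' - U_(i)])^`M(j) = f^`M[m - U_(i)].
  rewrite -mderivmU1m -mderivmDm; congr (_^`M[_]); apply/mnmP => l.
  rewrite [in RHS]mE !(mnmDE, mnmBE, mnm1E).
  by case: (i =P l) => [<-|_]; rewrite ?subn0 // addnBAC.
rewrite mi natrD scalerDl addrC; congr (_ + _); case: eqP => [ij|_]; last first.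
  by rewrite mul0r scale0r.
by rewrite mul1r scale1r ij mE addmK.
Qed.

(** Leibniz' rule for a product with a variable: the commutator of [p(D)] with the
    variable is the operator of the derivative of [p]. *)
Lemma diffop_mulX p f i :
  diffop p ('X_i * f) = 'X_i * diffop p f + diffop p^`M(i) f.
Proof.
elim/mpolyind: p => [|c m p _ _ IH].
  by rewrite mderiv0 /diffop msupp0 !big_nil mulr0 addr0.
have dl g := diffop_linear g; rewrite (dl ('X_i * f)) IH (dl f) mderivD mderivZ mderivX (dl f).
have -> : diffop ((m i)%:R *: 'X_[m - U_(i)]) f = (m i)%:R *: f^`M[m - U_(i)].
  have := dl f (m i)%:R 'X_[m - U_(i)] 0; rewrite addr0 diffopX => ->.
  by rewrite /diffop msupp0 big_nil addr0.
rewrite !diffopX mderivm_mulX scalerDr mulrDr -scalerAr -!addrA; congr (_ + _).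
by rewrite addrCA.
Qed.

Definition diffop_at p x f : k := (diffop p f).@[x 0].

Lemma diffop_at_linearl x f : linear_for *%R (fun p => diffop_at p x f).
Proof. by move=> c p q; rewrite /diffop_at diffop_linear mevalD mevalZ. Qed.

Lemma diffop_at0l x f : diffop_at 0 x f = 0.
Proof. by rewrite /diffop_at /diffop msupp0 big_nil meval0. Qed.

Lemma diffop_at_linear p x : linear_for *%R (diffop_at p x).
Proof.
move=> c f h; rewrite /diffop_at -mevalZ -mevalD; congr (_.@[_]).
rewrite /diffop scaler_sumr -big_split /=; apply: eq_bigr => m _.
by rewrite linearP /= scalerDr !scalerA mulrC.
Qed.

HB.instance Definition _ p x := GRing.isLinear.Build k A k _ (diffop_at p x)
  (diffop_at_linear p x).

Lemma diffop_at_sum x f (I : Type) (r : seq I) (P : pred I) (c : I -> k) (q : I -> A) :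
  diffop_at (\sum_(i <- r | P i) c i *: q i) x f =
  \sum_(i <- r | P i) c i * diffop_at (q i) x f.
Proof.
have l := diffop_at_linearl x f.
elim/big_rec2: _ => [|i u v _ <-]; last exact: l.
by have := l (-1) 0 0; rewrite scaler0 addr0 mulN1r addNr.
Qed.

Lemma diffop_at_mulX p x f i :
  diffop_at p x ('X_i * f) = x 0 i * diffop_at p x f + diffop_at p^`M(i) x f.
Proof. by rewrite /diffop_at diffop_mulX mevalD mevalM mevalXU. Qed.

Lemma diffop_at_mul_shift p x f i :
  diffop_at p x (('X_i - (x 0 i)%:MP) * f) = diffop_at p^`M(i) x f.
Proof.
by rewrite mulrBl linearB /= diffop_at_mulX mul_mpolyC linearZ /= addrC addKr.
Qed.

Lemma diffop_at1 p x : diffop_at p x 1 = p@_0.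
Proof.
have d1 m : (1 : A)^`M[m] = (m == 0%MM)%:R.
  have [->|m0] := eqVneq m 0%MM; first by rewrite mderivm0m.
  have [i mi] : exists i, (0 < m i)%N by apply: mdeg_gt0; rewrite lt0n mdeg_eq0.
  have -> : m = (U_(i) + (m - U_(i)))%MM by rewrite addmC submK // lep1mP -lt0n.
  by rewrite mderivmDm mderivmU1m -mpolyC1 mderivC raddf0.
rewrite {1}[p]mpolyE diffop_at_sum.
transitivity (\sum_(m <- msupp p) p@_m * (m == 0%MM)%:R).
  apply: eq_bigr => m _; rewrite /diffop_at diffopX d1.
  by case: eqP => _; rewrite ?meval1 ?meval0.
rewrite [in RHS](mpolyE p) linear_sum /=; apply: eq_bigr => m _.
by rewrite mcoeffZ mcoeffX.
Qed.

Definition shifted_monomial x m : A := \prod_i ('X_i - (x 0 i)%:MP) ^+ m i.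

Lemma shifted_monomialS x m i :
  shifted_monomial x (m + U_(i)) = ('X_i - (x 0 i)%:MP) * shifted_monomial x m.
Proof.
rewrite /shifted_monomial (bigD1 i) //= [X in _ = _ * X](bigD1 i) //=.
rewrite mnmDE mnm1E eqxx addn1 exprS -mulrA; congr (_ * (_ * _)).
by apply: eq_bigr => j ji; rewrite mnmDE mnm1E eq_sym (negPf ji) addn0.
Qed.

Lemma shifted_monomial0 x : shifted_monomial x 0 = 1.
Proof. by rewrite /shifted_monomial big1 // => i _; rewrite mnm0E. Qed.

Lemma mnm_ind (P : 'X_{1..n} -> Prop) :
  P 0%MM -> (forall m i, P m -> P (m + U_(i))%MM) -> forall m, P m.
Proof.
move=> P0 PS m; have [K] := ubnP (mdeg m); elim: K m => // K IH m mK.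
have [->//|m0] := eqVneq m 0%MM.
have [j mj] : exists j, (0 < m j)%N by apply: mdeg_gt0; rewrite lt0n mdeg_eq0.
have mE : m = (m - U_(j) + U_(j))%MM by rewrite submK // lep1mP -lt0n.
rewrite mE; apply/PS/IH; move: mK; rewrite {1}mE mdegD mdeg1; lia.
Qed.

(** The span of the products of the [X_i - x_i] is stable under multiplication by the
    variables. *)
Lemma shifted_monomial_span x (T : {scalar A}) :
  (forall m, T (shifted_monomial x m) = 0) -> forall f, T f = 0.
Proof.
move=> T0 f; suff H h : forall m, T (h * shifted_monomial x m) = 0.
  by rewrite -[f]mulr1 -(shifted_monomial0 x).
elim/mpoly_mulX_ind: h => [c u v Hu Hv m|m|i u Hu m].
- by rewrite mulrDl -scalerAl linearP /= Hu Hv mulr0 addr0.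
- by rewrite mul1r.
have -> : 'X_i * u * shifted_monomial x m =
    u * shifted_monomial x (m + U_(i)) + x 0 i *: (u * shifted_monomial x m).
  by rewrite shifted_monomialS -mul_mpolyC; ring.
by rewrite linearD linearZ /= !Hu mulr0 addr0.
Qed.

Definition mnm_fact m : nat := (\prod_i (m i)`!)%N.

Lemma diffop_at_shifted_monomial p x m :
  diffop_at p x (shifted_monomial x m) = p@_m *+ mnm_fact m.
Proof.
have -> : diffop_at p x (shifted_monomial x m) = (p^`M[m])@_0.
  elim/mnm_ind: m p => [|m i IH] p.
    by rewrite shifted_monomial0 diffop_at1 mderivm0m.
  by rewrite shifted_monomialS diffop_at_mul_shift IH addmC mderivmDm mderivmU1m.
rewrite mcoeff_mderivm addm0; congr (_ *+ _); apply: eq_bigr => i _.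
exact: ffactnn.
Qed.

(** Without a restriction on the characteristic this fails: [p(D)] is zero
    for [p = X ^ q] in characteristic [q]. *)
Lemma diffop_at_inj p x : (forall m, (mnm_fact m)%:R != 0 :> k) ->
  (forall f, diffop_at p x f = 0) -> p = 0.
Proof.
move=> fact0 Hp; apply/mpolyP => m; rewrite mcoeff0; apply/eqP.
have /eqP := Hp (shifted_monomial x m).
by rewrite diffop_at_shifted_monomial -mulr_natr mulf_eq0 (negPf (fact0 m)) orbF.
Qed.

End ConstantCoefficientOperators.

(** * Local duality *)

Section InverseSystem.
Context {k : fieldType} {n : nat}.
Local Notation A := {mpoly k[n]}.
Implicit Types (s : seq A) (p f h : A) (x : 'rV[k]_n) (m : 'X_{1..n}).

Definition inverse_system s x : set A :=
  [set p | forall f, in_ideal s f -> diffop_at p x f = 0].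

Lemma inverse_system_linear s x c p q :
  inverse_system s x p -> inverse_system s x q -> inverse_system s x (c *: p + q).
Proof.
by move=> Hp Hq f Hf; rewrite diffop_at_linearl Hp // Hq // mulr0 addr0.
Qed.

Lemma inverse_system0 s x : inverse_system s x 0.
Proof. by move=> f _; apply: diffop_at0l. Qed.

Lemma inverse_system_sum s x (I : Type) (r : seq I) (c : I -> k) (p : I -> A) :
  (forall i, inverse_system s x (p i)) -> inverse_system s x (\sum_(i <- r) c i *: p i).
Proof.
move=> Hp; elim/big_rec: _ => [|i q _ Hq]; first exact: inverse_system0.
exact: inverse_system_linear.
Qed.

Lemma inverse_system_mderiv s x p i :
  inverse_system s x p -> inverse_system s x p^`M(i).
Proof.
move=> Hp f Hf; have := diffop_at_mulX p x f i.
by rewrite !Hp ?mulr0 ?add0r //; apply: in_idealMl.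
Qed.

Lemma inverse_system_mderivm s x p m :
  inverse_system s x p -> inverse_system s x p^`M[m].
Proof.
elim/(@mnm_ind n): m p => [|m i IH] p Hp; first by rewrite mderivm0m.
by rewrite mderivmDm mderivmU1m; apply/inverse_system_mderiv/IH.
Qed.

(** Multiplying [f] by a variable amounts to differentiating [p], so the conditions
    on the derivatives of [p] at the generators express the vanishing of [p(D)] at
    [x] on the ideal. *)
Lemma dual_spaceE (g : 'I_n -> A) x :
  dual_space g x = inverse_system [seq g i | i <- enum 'I_n] x.
Proof.
apply/seteqP; split=> [p Hp|p Hp i m]; last first.
  apply: (inverse_system_mderivm m Hp); apply: in_ideal_mem.
  by apply: map_f; rewrite mem_enum.
have Hg i h : forall m, diffop_at p^`M[m] x (h * g i) = 0.
  elim/(@mpoly_mulX_ind k n): h => [c u v Hu Hv m|m|j u Hu m].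
  - by rewrite mulrDl -scalerAl linearP /= Hu Hv mulr0 addr0.
  - by rewrite mul1r; apply: Hp.
  by rewrite -mulrA diffop_at_mulX Hu mulr0 add0r -mderivmU1m -mderivmDm Hu.
move=> f; elim: (enum 'I_n) f => [f ->|i r IH f /= [c /IH Hc]]; first exact: raddf0.
by rewrite -(subrK (c * g i) f) linearD /= Hc add0r -[p]mderivm0m Hg.
Qed.

Lemma mderivm_eq0 p m : (msize p <= mdeg m)%N -> p^`M[m] = 0.
Proof.
move=> pm; apply/mpolyP => m'; rewrite mcoeff_mderivm mcoeff0.
rewrite memN_msupp_eq0 ?mul0rn //; apply: msize_mdeg_ge.
by rewrite mdegD (leq_trans pm) // leq_addr.
Qed.

End InverseSystem.

Section LocalDuality.
Context {k : closedFieldType} {n : nat}.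
Local Notation A := {mpoly k[n]}.
Variables (s : seq A) (N : nat) (b : 'I_N.+1 -> A).
Hypothesis Hb : quotient_basis s b.
Implicit Types (p f u v : A) (x : 'rV[k]_n) (m : 'X_{1..n}) (c : 'rV[k]_N.+1).

Definition coordinates u : 'rV[k]_N.+1 := projT1 (cid (Hb.2 u)).

Lemma coordinatesP u : in_ideal s (u - \sum_i coordinates u 0 i *: b i).
Proof. by rewrite /coordinates; case: cid. Qed.

Lemma coordinates_eq u c : in_ideal s (u - \sum_i c 0 i *: b i) -> coordinates u = c.
Proof.
move=> Hc; apply/eqP; rewrite -subr_eq0; apply/eqP/Hb.1.
have -> : \sum_i (coordinates u - c) 0 i *: b i =
    (u - \sum_i c 0 i *: b i) - (u - \sum_i coordinates u 0 i *: b i).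
  transitivity (\sum_i coordinates u 0 i *: b i - \sum_i c 0 i *: b i); last by ring.
  by rewrite -sumrB; apply: eq_bigr => i _; rewrite !mxE scalerBl.
by apply: in_idealB => //; apply: coordinatesP.
Qed.

Lemma coordinates_is_linear : linear coordinates.
Proof.
move=> a u v; apply: coordinates_eq.
have -> : a *: u + v - \sum_i (a *: coordinates u + coordinates v) 0 i *: b i =
    a%:MP * (u - \sum_i coordinates u 0 i *: b i) + (v - \sum_i coordinates v 0 i *: b i).
  rewrite mul_mpolyC scalerBr addrACA -opprD; congr (_ - _).
  rewrite scaler_sumr -big_split /=; apply: eq_bigr => i _.
  by rewrite !mxE scalerDl scalerA.
by apply: in_idealD; first apply: in_idealMl; apply: coordinatesP.
Qed.

HB.instance Definition _ := GRing.isLinear.Build k A 'rV[k]_N.+1 _ coordinates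
  coordinates_is_linear.

Lemma coordinates_ideal u : in_ideal s u -> coordinates u = 0.
Proof.
move=> Hu; apply: coordinates_eq; rewrite big1 ?subr0 // => i _.
by rewrite mxE scale0r.
Qed.

Lemma coordinates_basis j : coordinates (b j) = delta_mx 0 j.
Proof.
apply: coordinates_eq; rewrite (bigD1 j) //= mxE !eqxx scale1r big1 ?addr0 ?subrr.
  exact: in_ideal0.
by move=> i ij; rewrite mxE (negPf ij) andbF scale0r.
Qed.

(** The linear forms on the quotient are the rows [c] over the basis [b]. *)
Definition functional c u : k := \sum_i coordinates u 0 i * c 0 i.

Lemma functional_is_linear c : linear_for *%R (functional c).
Proof.
move=> a u v; rewrite /functional linearP mulr_sumr -big_split /=.
by apply: eq_bigr => i _; rewrite !mxE mulrDl mulrA.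
Qed.

HB.instance Definition _ c := GRing.isLinear.Build k A k _ (functional c)
  (functional_is_linear c).

Lemma functional_ideal c u : in_ideal s u -> functional c u = 0.
Proof.
by move=> /coordinates_ideal Hu; rewrite /functional Hu big1 // => i _; rewrite mxE mul0r.
Qed.

Lemma functional_basis c j : functional c (b j) = c 0 j.
Proof.
rewrite /functional coordinates_basis (bigD1 j) //= mxE !eqxx mul1r big1 ?addr0 //.
by move=> i ij; rewrite mxE (negPf ij) andbF mul0r.
Qed.

Lemma functional_inj c c' : functional c =1 functional c' -> c = c'.
Proof. by move=> e; apply/rowP => j; rewrite -!functional_basis e. Qed.

(** On rows, which stand for linear forms, this matrix acts from the right as the
    transpose of multiplication by the [i]-th variable on the quotient. *)
Definition mulX_mx i : 'M[k]_N.+1 := \matrix_(l, j) coordinates ('X_i * b j) 0 l.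

Lemma functional_eq_mod c u v : in_ideal s (u - v) -> functional c u = functional c v.
Proof.
by move/(functional_ideal c); rewrite linearB /= => /eqP; rewrite subr_eq0 => /eqP.
Qed.

Lemma functional_mulX c i u : functional (c *m mulX_mx i) u = functional c ('X_i * u).
Proof.
have e j : (c *m mulX_mx i) 0 j = functional c ('X_i * b j).
  by rewrite mxE; apply: eq_bigr => l _; rewrite !mxE mulrC.
have -> : functional c ('X_i * u) =
    functional c (\sum_j coordinates u 0 j *: ('X_i * b j)).
  apply: functional_eq_mod.
  have -> : \sum_j coordinates u 0 j *: ('X_i * b j) =
      'X_i * \sum_j coordinates u 0 j *: b j.
    by rewrite mulr_sumr; apply: eq_bigr => j _; rewrite scalerAr.
  by rewrite -mulrBr; apply/in_idealMl/coordinatesP.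
by rewrite linear_sum /=; apply: eq_bigr => j _; rewrite linearZ /= e.
Qed.

Lemma mulX_mx_comm i j : mulX_mx i *m mulX_mx j = mulX_mx j *m mulX_mx i.
Proof.
apply/row_matrixP => l; rewrite !rowE; apply: functional_inj => u.
by rewrite !mulmxA !functional_mulX mulrCA.
Qed.

Lemma functional_shift c i (z : k) (m : nat) u :
  functional (c *m horner_mx (mulX_mx i) (('X - z%:P) ^+ m)) u =
  functional c (('X_i - z%:MP) ^+ m * u).
Proof.
have shift1 d w : functional (d *m (mulX_mx i - z%:M)) w =
    functional d (('X_i - z%:MP) * w).
  rewrite mulmxBr mul_mx_scalar mulrBl linearB /= -functional_mulX mul_mpolyC.
  rewrite [functional d (z *: w)]linearZ /=.
  rewrite /functional mulr_sumr -sumrB; apply: eq_bigr => j _.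
  by rewrite !mxE; ring.
rewrite rmorphXn rmorphB /= horner_mx_X horner_mx_C.
elim: m c u => [|m IH] c u; first by rewrite !expr0 mulmx1 mul1r.
by rewrite exprSr -mulmxE mulmxA shift1 IH mulrA -exprSr.
Qed.

Definition restriction p x : 'rV[k]_N.+1 := \row_j diffop_at p x (b j).

Lemma functional_restriction p x u :
  inverse_system s x p -> functional (restriction p x) u = diffop_at p x u.
Proof.
move=> Hp; have /eqP := Hp _ (coordinatesP u).
rewrite linearB subr_eq0 /= => /eqP ->; rewrite linear_sum /=.
by apply: eq_bigr => i _; rewrite mxE linearZ.
Qed.

Lemma restriction_linear a p q x :
  restriction (a *: p + q) x = a *: restriction p x + restriction q x.
Proof. by apply/rowP => j; rewrite !mxE diffop_at_linearl. Qed.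

Lemma restriction_sum (I : finType) (a : I -> k) (p : I -> A) x :
  restriction (\sum_i a i *: p i) x = \sum_i a i *: restriction (p i) x.
Proof.
apply/rowP => j; rewrite mxE diffop_at_sum summxE.
by apply: eq_bigr => i _; rewrite !mxE.
Qed.

Local Notation joint := (joint_geigenspace mulX_mx).

(** The operator [X_i - x_i] acts on [p] as differentiation, which is nilpotent. *)
Lemma restriction_joint p x : inverse_system s x p -> (restriction p x <= joint x)%MS.
Proof.
move=> Hp; apply/joint_geigenspaceP => i; apply: (@in_geigenspace _ _ _ _ _ (msize p)).
apply: functional_inj => u; rewrite functional_shift functional_restriction //.
have -> (e : nat) : diffop_at p x (('X_i - (x 0 i)%:MP) ^+ e * u) = diffop_at p^`M(i, e) x u.
  elim: e u => [|e IH] u; first by rewrite expr0 mul1r mderivn0.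
  by rewrite exprSr -mulrA IH diffop_at_mul_shift mderivnS.
rewrite mderivm_eq0; last by rewrite mdegMn mdeg1 mul1n.
rewrite diffop_at0l /functional big1 // => j _.
by rewrite mxE mulr0.
Qed.

Lemma functional_shifted_monomial c x m :
  (c <= joint x)%MS -> (n * N < mdeg m)%N -> functional c (shifted_monomial x m) = 0.
Proof.
(* If all n exponents were at most N, their sum would be at most n * N. *)
move=> Hc mN; have [i mi] : exists i, (N < m i)%N.
  apply/existsP; apply: contraTT mN => /existsPn H; rewrite -leqNgt mdegE.
  rewrite -[n in (n * N)%N]card_ord -sum_nat_const; apply: leq_sum => i _.
  by rewrite leqNgt.
have /joint_geigenspaceP/(_ i) := Hc; rewrite in_kermxpoly => /eqP ci.
rewrite /shifted_monomial (bigD1 i) //= -(subnKC mi) exprD -mulrA.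
by rewrite -functional_shift ci /functional big1 // => j _; rewrite mxE mulr0.
Qed.

Hypothesis fact_neq0 : forall m : 'X_{1..n}, (mnm_fact m)%:R != 0 :> k.

(** The polynomial is read off from the values of the functional on the
    monomials in [X_i - x_i]. *)
Lemma restriction_surj c x : (c <= joint x)%MS ->
  exists2 p, inverse_system s x p & restriction p x = c.
Proof.
(* From degree B on, the functional vanishes on the shifted monomials. *)
move=> Hc; pose B := (n * N).+1.
pose e m := functional c (shifted_monomial x m) / (mnm_fact m)%:R.
pose p := \sum_(m : 'X_{1..n < B}) e m *: 'X_[m].
have pf u : diffop_at p x u = functional c u.
  apply/eqP; rewrite -subr_eq0; apply/eqP.
  apply: (shifted_monomial_span (x := x) (T := diffop_at p x \- functional c)) => m /=.
  rewrite diffop_at_shifted_monomial; have [mB|Bm] := ltnP (mdeg m) B.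
    by rewrite mcoeff_mpoly // -mulr_natr divfK ?subrr.
  rewrite functional_shifted_monomial // memN_msupp_eq0 ?mul0rn ?subr0 //.
  apply: msize_mdeg_ge; apply: leq_trans Bm.
  rewrite (leq_trans (msize_sum _ _ _)) //; apply/bigmax_leqP => m' _.
  by rewrite (leq_trans (msizeZ_le _ _)) // msizeX bmdeg.
exists p => [u /functional_ideal Hu|]; first by rewrite pf Hu.
by apply/rowP => j; rewrite mxE pf functional_basis.
Qed.

Lemma restriction_inj p x : inverse_system s x p -> restriction p x = 0 -> p = 0.
Proof.
move=> Hp p0; apply: (diffop_at_inj (x := x)) => // u.
by rewrite -functional_restriction // p0 /functional big1 // => j _; rewrite mxE mulr0.
Qed.

(** Restriction to the basis [b] is an isomorphism of the inverse system onto the joint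
    generalized eigenspace. *)
Lemma inverse_system_basis x : exists p : 'I_(\rank (joint x)) -> A,
  is_basis (inverse_system s x) p.
Proof.
pose J := row_base (joint x).
have /choice[p Hp] i : exists p, inverse_system s x p /\ restriction p x = row i J.
  have [|p ? ?] := @restriction_surj (row i J) x; last by exists p.
  by rewrite (submx_trans (row_sub _ _)) // eq_row_base.
have pJ (a : 'I_(\rank (joint x)) -> k) :
    restriction (\sum_i a i *: p i) x = (\row_i a i) *m J.
  rewrite restriction_sum mulmx_sum_row; apply: eq_bigr => i _.
  by rewrite (Hp i).2 mxE.
exists p; split=> [a a0 i|].
  have := pJ a; rewrite a0.
  have -> : restriction 0 x = 0.
    by apply/rowP => j; rewrite !mxE diffop_at0l.
  move/esym/(congr1 (mulmx^~ (pinvmx J))); rewrite mul0mx mulmxKp ?row_base_free //.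
  by move/rowP/(_ i); rewrite !mxE.
apply/seteqP; split=> [_ [a ->]|q Hq].
  by apply: inverse_system_sum => i; case: (Hp i).
have /submxP[D HD] : (restriction q x <= J)%MS by rewrite eq_row_base restriction_joint.
exists (D 0); apply/eqP; rewrite -subr_eq0 -scaleN1r addrC.
have HS : inverse_system s x (\sum_i D 0 i *: p i).
  by apply: inverse_system_sum => i; case: (Hp i).
apply/eqP/(@restriction_inj _ x); first exact: inverse_system_linear.
rewrite restriction_linear pJ HD scaleN1r.
have -> : \row_i D 0 i = D by apply/rowP => i; rewrite mxE.
by rewrite addNr.
Qed.

End LocalDuality.

Section SumOfMultiplicities.
Context {k : closedFieldType} {n : nat}.
Local Notation A := {mpoly k[n]}.
Hypothesis fact_neq0 : forall m : 'X_{1..n}, (mnm_fact m)%:R != 0 :> k.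

(** The inverse system at [x] is identified with the joint generalized eigenspace, for
    the eigenvalues [x], of the transposed multiplications on the quotient; these
    eigenspaces split the dual of the quotient. *)
Theorem inverse_system_count (s : seq A) N (b : 'I_N -> A) : quotient_basis s b ->
  exists (mu : 'rV[k]_n -> nat) (pts : seq 'rV[k]_n),
    [/\ forall x, exists p : 'I_(mu x) -> A, is_basis (inverse_system s x) p,
        uniq pts, forall x, x \notin pts -> mu x = 0%N &
        (\sum_(x <- pts) mu x = N)%N].
Proof.
case: N b => [|N] b Hb; last first.
  have [pts [upts Hpts sum]] := sum_rank_joint_geigenspace (mulX_mx_comm Hb).
  exists (fun x => \rank (joint_geigenspace (mulX_mx Hb) x)), pts; split=> // x.
    exact: inverse_system_basis.
  by move=> xp; apply/eqP; rewrite mxrank_eq0; apply: contraNT xp => /Hpts.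
exists (fun=> 0%N), [::]; split=> // [x|]; last by rewrite big_nil.
exists (fun=> 0); split=> [c _ []//|]; apply/seteqP; split=> [_ [c ->]|p Hp].
  by rewrite big_ord0; apply: inverse_system0.
exists (fun=> 0); rewrite big_ord0; apply: (diffop_at_inj (x := x)) => // f.
by apply: Hp; have [c] := Hb.2 f; rewrite big_ord0 subr0.
Qed.

End SumOfMultiplicities.

(** * The sum of multiplicities *)

Local Open Scope classical_set_scope.
Local Open Scope ring_scope.

Section DimensionOfSubspaces.
Context {K : fieldType} {V : lmodType K}.
Implicit Type U : set V.

Lemma independent_le_basis U d (b : 'I_d -> V) e (v : 'I_e -> V) :
  is_basis U b -> (forall i, U (v i)) -> linearly_independent v -> (e <= d)%N.
Proof.
move=> [_ <-] /choice[c Hc] vfree; rewrite leqNgt; apply/negP => de.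
have [a a0 Ha] := dependent_rows (fun i => \row_j c i j) de.
case/eqP: a0; apply/rowP => i; rewrite mxE; apply: vfree.
under eq_bigr => l _ do rewrite Hc scaler_sumr.
rewrite exchange_big big1 //= => j _.
under eq_bigr => l _ do rewrite scalerA.
rewrite -scaler_suml; move/rowP/(_ j): Ha; rewrite summxE mxE => Ha.
rewrite (_ : \sum_i0 _ = 0) ?scale0r // -[RHS]Ha.
by apply: eq_bigr => l _; rewrite !mxE.
Qed.

Lemma dimension_basis (R : realType) U d (b : 'I_d -> V) :
  is_basis U b -> dimension R U = d%:R%:E.
Proof.
move=> Ub; rewrite /dimension.
have -> : [set e | exists b0 : 'I_e -> V, is_basis U b0] = [set d].
  apply/seteqP; split=> [e [b' Ub']|_ ->]; last by exists b.
  have mem e' (c : 'I_e' -> V) : is_basis U c -> forall i, U (c i).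
    move=> [_ <-] i; exists (fun j => (j == i)%:R); rewrite (bigD1 i) //= eqxx.
    by rewrite scale1r big1 ?addr0 // => j /negPf ->; rewrite scale0r.
  apply/eqP; rewrite eqn_leq (independent_le_basis Ub (mem _ _ Ub') Ub'.1).
  exact: (independent_le_basis Ub' (mem _ _ Ub) Ub.1).
by rewrite image_set1 ereal_inf1.
Qed.

Lemma dimension_infinite (R : realType) U :
  (forall d, exists2 v : 'I_d -> V, forall i, U (v i) & linearly_independent v) ->
  dimension R U = +oo%E.
Proof.
move=> HU; rewrite /dimension.
have -> : [set e | exists b0 : 'I_e -> V, is_basis U b0] = set0.
  apply/seteqP; split=> [e [b Ub]|//]; have [v vU vfree] := HU e.+1.
  by have := independent_le_basis Ub vU vfree; rewrite ltnn.
by rewrite image_set0 ereal_inf0.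
Qed.

End DimensionOfSubspaces.

Section PositiveCharacteristic.
Context {k : fieldType} {n : nat}.
Local Notation A := {mpoly k[n]}.

Lemma derivative_pchar q p (i : 'I_n) (m : 'X_{1..n}) : q \in [pchar k] -> (q %| p)%N ->
  m != 0%MM -> ('X_[U_(i) *+ p] : A)^`M[m] = 0.
Proof.
move=> chq qp m0; rewrite mderivmX.
have [j mj] : exists j, (0 < m j)%N by apply: mdeg_gt0; rewrite lt0n mdeg_eq0.
suff /eqP -> : (\prod_(l < n) ((U_(i) *+ p)%MM l) ^_ (m l))%:R == 0 :> k by rewrite scale0r.
rewrite -(dvdn_pcharf chq) (bigD1 j) //= dvdn_mulr // mulmnE mnm1E.
case: (m j) mj => // e _; rewrite ffactnS dvdn_mulr // dvdn_mull //.
Qed.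

(** In characteristic [q] the operator [D ^ p] is zero for every positive multiple
    [p] of [q], and so are the derivatives of [X ^ p]. *)
Lemma dual_space_pchar q p (g : 'I_n -> A) (x : 'rV[k]_n) (i : 'I_n) :
  q \in [pchar k] -> (0 < p)%N -> (q %| p)%N -> dual_space g x 'X_[U_(i) *+ p].
Proof.
move=> chq p_gt0 qp j m; suff -> : diffop ('X_[U_(i) *+ p])^`M[m] (g j) = 0.
  by rewrite meval0.
have [->|m0] := eqVneq m 0%MM; last first.
  by rewrite (derivative_pchar _ chq) // /diffop msupp0 big_nil.
rewrite mderivm0m diffopX; apply/mpolyP => m'; rewrite mcoeff_mderivm mcoeff0.
rewrite -mulr_natr; apply/eqP; rewrite mulf_eq0 -(dvdn_pcharf chq) orbC.
rewrite (bigD1 i) //= dvdn_mulr // mnmDE mulmnE mnm1E eqxx mul1n.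
rewrite -bin_ffact dvdn_mull // dvdn_fact //; have := pcharf_prime chq.
by move/prime_gt0 => -> /=; apply: dvdn_leq.
Qed.

(** The monomials [X_i ^ (q * j)], for [j > 0], are linearly independent elements. *)
Lemma dimension_dual_space_pchar (R : realType) q (g : 'I_n -> A) (x : 'rV[k]_n) (i : 'I_n) :
  q \in [pchar k] -> dimension R (dual_space g x) = +oo%E.
Proof.
move=> chq; have q_gt0 := prime_gt0 (pcharf_prime chq).
apply: dimension_infinite => d.
exists (fun j : 'I_d => 'X_[U_(i) *+ (q * j.+1)]).
  by move=> j; apply: (dual_space_pchar _ _ _ chq); rewrite ?muln_gt0 ?q_gt0 ?dvdn_mulr.
move=> c c0 j; move/(congr1 (mcoeff (U_(i) *+ (q * j.+1)))): c0.
rewrite mcoeff0 linear_sum (bigD1 j) //= mcoeffZ mcoeffX eqxx mulr1 big1 ?addr0 //.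
move=> l lj; rewrite mcoeffZ mcoeffX; case: eqP => [e|]; last by rewrite mulr0.
case/eqP: lj; apply/val_inj; move/(congr1 (fun m : 'X_{1..n} => m i)): e.
rewrite !mulmnE mnm1E eqxx !mul1n => /eqP; rewrite eqn_pmul2l // eqSS => /eqP.
by [].
Qed.

End PositiveCharacteristic.

Section Bezout.
Context {k : closedFieldType}.

(** Polynomials of positive degree in at least one variable are covered by Bezout's
    theorem for their top components; a nonzero constant generates the unit ideal. *)
Lemma exists_quotient_basis n (g : 'I_n -> {mpoly k[n]}) :
  (forall i, g i != 0) -> no_intersection_at_infinity g ->
  exists b : 'I_(\prod_i deg (g i)) -> {mpoly k[n]},
    quotient_basis [seq g i | i <- enum 'I_n] b.
Proof.
move=> g0 ginf; have [/forallP dg|/forallPn[i]] := boolP [forall i, 0 < deg (g i)]%N;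
  last first.
  rewrite -eqn0Ngt => /eqP di; rewrite (bigD1 i) //= di mul0n.
  exists (fun=> 0); split=> [c _|u]; first by apply/rowP => -[].
  exists 0; rewrite big_ord0 subr0 -[u]mulr1; apply: in_idealMl.
  have gi : g i = ((g i)@_0)%:MP.
    by apply: msize1_polyC; rewrite (mpolySpred mdeg (g0 i)) -/(deg _) di.
  have c0 : (g i)@_0 != 0 by apply: contraNneq (g0 i) => c0; rewrite gi c0 mpolyC0.
  rewrite -mpolyC1 -(mulVf c0) mpolyCM -gi; apply/in_idealMl/in_ideal_mem/map_f.
  by rewrite mem_enum.
case: n g g0 ginf dg => [|n] g g0 ginf dg.
  rewrite big_ord0; exists (fun=> 1).
  have -> : enum 'I_0 = [::] := size0nil (size_enum_ord 0).
  have m0 (m : 'X_{1..0}) : m = 0%MM by apply/mnmP => -[].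
  split=> /= [c|u].
    rewrite big_ord1 => /(congr1 (mcoeff 0)); rewrite mcoeffZ mcoeff1 eqxx mulr1 mcoeff0 => c0.
    by apply/rowP => i; rewrite ord1 c0 mxE.
  exists (const_mx u@_0); rewrite big_ord1 mxE; apply/eqP; rewrite subr_eq0; apply/eqP/mpolyP => m.
  by rewrite (m0 m) mcoeffZ mcoeff1 eqxx mulr1.
pose s := [seq g i | i <- enum 'I_n.+1].
have Hs : all (fun a => 0 < deg a)%N s by apply/allP => _ /mapP[i _ ->].
have Ht := all_is_form_tops Hs.
have Hirr : irrelevant [seq top_component a | a <- s].
  apply: projective_nullstellensatz; first exact: all_form_homogeneous.
  move=> y Hy; apply: contrapT => /eqP y0; apply: ginf; exists y; split=> // i.
  by apply: Hy; rewrite map_f // map_f // mem_enum.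
have st : size [seq top_component a | a <- s] = n.+1.
  by rewrite size_map size_map size_enum_ord.
have [rs cs] := bezout_forms st Ht Hirr.
have [b Hb] := bezout_quotient_basis Hs rs cs.
suff -> : (\prod_i deg (g i) = \prod_(a <- [seq top_component a | a <- s]) deg a)%N.
  by exists b.
rewrite big_map big_map big_enum; apply: eq_bigr => i _; exact/esym/deg_top_component.
Qed.

End Bezout.

(* R only hosts the extended natural numbers in which multiplicities and their
   sum take values. *)
Theorem mainTheorem1 (R : realType) (k : closedFieldType) (n : nat)
    (g : 'I_n -> {mpoly k[n]}) (g_neq0 : forall i, g i != 0)
    (g_inf : no_intersection_at_infinity g) :
  \esum_(x in [set: 'rV[k]_n]) multiplicity R g x = (\prod_i deg (g i))%:R%:E \/
  \esum_(x in [set: 'rV[k]_n]) multiplicity R g x = +oo%E.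
Proof.
have [fact_neq0|] := pselect (forall m : 'X_{1..n}, (mnm_fact m)%:R != 0 :> k).
  left; have [b Hb] := exists_quotient_basis g_neq0 g_inf.
  have [mu [pts [basis_mu upts mu0 sum_mu]]] := inverse_system_count fact_neq0 Hb.
  have dim_mu x : multiplicity R g x = (mu x)%:R%:E.
    by have [p Hp] := basis_mu x; apply: (dimension_basis R (b := p)); rewrite dual_spaceE.
  rewrite (eq_esum (fun x _ => dim_mu x)).
  rewrite (esumID [set` pts]) => [|x _]; last by rewrite lee_fin Num.Theory.ler0n.
  rewrite !setTI [X in (_ + X)%E]esum1 ?adde0; last first.
    by move=> x /= xp; rewrite mu0 //; apply/negP.
  rewrite esum_fset; first last.
  - by move=> x _; rewrite lee_fin Num.Theory.ler0n.
  - exact: finite_seq.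
  by rewrite -fsbig_seq // sumEFin -natr_sum sum_mu.
move=> /existsNP[m /negP]; rewrite negbK => m0; right.
have [q chq] := natf0_pchar (prodn_gt0 (fun i => fact_gt0 (m i))) m0.
have [i _] : exists i : 'I_n, true.
  case: n m m0 {g g_neq0 g_inf} => [|n] m; last by exists ord0.
  by rewrite /mnm_fact big_ord0 oner_eq0.
apply/eqP; rewrite -leye_eq; apply: esum_ge; exists [set 0].
  by split=> //; apply: finite_set1.
by rewrite fsbig_set1 /multiplicity (dimension_dual_space_pchar _ _ _ i chq).
Qed.
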